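(* Let $\mathfrak{n}_0=U\oplus\mathfrak{g}_0$ be the real 2-step nilpotent metric Lie algebra with Chevalley rational structure $\mathfrak{n}_{0,\mathbb{Q}}$ described in the context. Let $\lambda\in\Lambda$ and $\beta\in\Phi^+$ be linearly independent. Define $U'_{\lambda,\beta}=\sum_{k=-\infty}^{\infty}U_{\lambda+k\beta}$. Let $\mathfrak{n}_0(\lambda,\beta)=U'_{\lambda,\beta}\oplus\mathfrak{g}_{\lambda,\beta}$, where $\mathfrak{g}_{\lambda,\beta}=\mathfrak{g}_{0,\beta}\oplus\mathbb{R}\tilde H_\lambda\oplus\mathbb{R}\tilde\tau_\beta$. Then 1) $\mathfrak{g}_{\lambda,\beta}$ is a Lie subalgebra of $\mathfrak{g}_0$ that is Lie algebra isomorphic to the quaternions $\mathbb{H}$ with the Lie algebra structure given by $[x,y]=xy-yx$ for all $x,y\in\mathbb{H}$. Moreover, $\mathfrak{g}_{\lambda,\beta}$ is rational with respect to the rational structure $\mathbb{Q}\text{-span}(\mathfrak{C}_0)$ for $\mathfrak{g}_0$. 2) $U'_{\lambda,\beta}$ is a $\mathfrak{g}_{\lambda,\beta}$-module. 3) If $2\lambda+p\beta\notin\Phi$ for any integer $p$, then $\mathfrak{n}_0(\lambda,\beta)$ is a totally geodesic subalgebra of $\mathfrak{n}_0$ with 4-dimensional center $\mathfrak{g}_{\lambda,\beta}$ that is rational with respect to the Chevalley rational structure $\mathfrak{n}_{0,\mathbb{Q}}$ on $\mathfrak{n}_0$.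
   Context: $\mathfrak{g}_0$ is a compact semisimple real Lie algebra with Killing form $B_0$ (negative definite), $U$ a finite dimensional real $\mathfrak{g}_0$-module, $\mathfrak{h}_0$ a maximal abelian subalgebra of $\mathfrak{g}_0$, $\mathfrak{h}=\mathfrak{h}_0^{\mathbb{C}}$, $\mathfrak{g}=\mathfrak{g}_0^{\mathbb{C}}$, $V=U^{\mathbb{C}}$; $\Phi$ are the roots of $\mathfrak{h}$ with base $\Delta$ and positive roots $\Phi^+$, $\Lambda$ the nonzero weights of $V$; $V_\lambda=\{v\in V:Hv=\lambda(H)v\ \forall H\in\mathfrak{h}\}$, $U_\lambda=(V_\lambda\oplus V_{-\lambda})\cap U$ for $\lambda\in\Lambda$, $U_0=V_0\cap U$, and $U_\mu=\{0\}$ for nonzero $\mu\notin\Lambda$. $\mathfrak{g}_\beta$ are the root spaces and $\mathfrak{g}_{0,\beta}=(\mathfrak{g}_\beta\oplus\mathfrak{g}_{-\beta})\cap\mathfrak{g}_0$ (2-dimensional) for $\beta\in\Phi$. Compact Chevalley basis: $\tau_\alpha=2H_\alpha/B(H_\alpha,H_\alpha)$ with $B$ the Killing form of $\mathfrak{g}$, $B(H,H_\alpha)=\alpha(H)$; $\tilde\tau_\alpha=i\tau_\alpha$ for $\alpha\in\Phi$. Let $\{X_\beta:\beta\in\Phi;\tau_\alpha:\alpha\in\Delta\}$ be a basis of $\mathfrak{g}$ with $X_\beta\in\mathfrak{g}_\beta$, $[X_\alpha,X_{-\alpha}]=\tau_\alpha$, $[X_\alpha,X_\beta]=C_{\alpha,\beta}X_{\alpha+\beta}$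 with $C_{\alpha,\beta}=-C_{-\alpha,-\beta}$ whenever $\alpha,\beta,\alpha+\beta\in\Phi$, such that $\mathfrak{C}_0=\{\tilde\tau_\alpha:\alpha\in\Delta;\ X_\beta-X_{-\beta},\ iX_\beta+iX_{-\beta}:\beta\in\Phi^+\}$ is an $\mathbb{R}$-basis of $\mathfrak{g}_0$. $\mathfrak{B}_0$ is a basis of $U$ such that $\mathfrak{C}_0$ leaves $\mathbb{Q}\text{-span}(\mathfrak{B}_0)$ invariant and $\mathfrak{B}_0$ is a union of bases of the subspaces $U_0$ and $U_\mu$, $\mu\in\Lambda$. The Chevalley rational structure is $\mathfrak{n}_{0,\mathbb{Q}}=\mathbb{Q}\text{-span}(\mathfrak{B}_0\cup\mathfrak{C}_0)$. A subspace is rational with respect to a rational structure (a $\mathbb{Q}$-form) if it has an $\mathbb{R}$-basis contained in it. $\langle\,,\rangle$ is an inner product on $\mathfrak{n}_0$ such that $U\perp\mathfrak{g}_0$, every $X\in\mathfrak{g}_0$ is skew symmetric on $U$, $\langle\,,\rangle=-B_0$ on $\mathfrak{g}_0$, and $\langle\xi,\xi'\rangle\in\mathbb{Q}$ for all $\xi,\xi'\in\mathfrak{B}_0\cup\mathfrak{C}_0$. The bracket on $\mathfrak{n}_0$: $\mathfrak{g}_0$ is central, $[\mathfrak{n}_0,\mathfrak{n}_0]\subseteq\mathfrak{g}_0$, $\langle[u,u'],Z\rangle=\langle Z(u),u'\rangle$ for $u,u'\in U$, $Z\in\mathfrak{g}_0$. (In 1) and 2) the original semisimple bracket of $\mathfrak{g}_0$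 and its action on $U$ are used.) $\tilde H_\lambda\in\mathfrak{h}_0$ is the unique vector with $\langle\tilde H,\tilde H_\lambda\rangle=-i\lambda(\tilde H)$ for all $\tilde H\in\mathfrak{h}_0$. Let $N_0$ be the simply connected Lie group with Lie algebra $\mathfrak{n}_0$ and the left invariant metric determined by $\langle\,,\rangle$. A subalgebra $\mathfrak{n}_0^*$ is totally geodesic if the subgroup $\exp(\mathfrak{n}_0^* )$ is a totally geodesic submanifold of $N_0$; equivalently $\nabla_XY\in\mathfrak{n}_0^*$ for all $X,Y\in\mathfrak{n}_0^*$, with $\nabla$ the Levi-Civita connection on left invariant fields. *)

(* Defs.v *)
From HB Require Import structures.
From mathcomp Require Import all_boot all_order all_algebra complex.
From mathcomp Require Import boolp classical_sets reals.

Set Implicit Arguments.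
Unset Strict Implicit.
Unset Printing Implicit Defensive.

Import Order.TTheory GRing.Theory Num.Theory.
Local Open Scope ring_scope.
Local Open Scope classical_set_scope.

(** * Linear algebra *)

(* The linear span of an arbitrary set; [vspanP] states that it is the least
   subspace containing the set. *)
Definition vspan (F : fieldType) (V : vectType F) (S : set V) : {vspace V} :=
  xget 0%VS [set W : {vspace V} | (forall v, S v -> v \in W) /\
    (forall W' : {vspace V}, (forall v, S v -> v \in W') -> (W <= W')%VS)].

Section Vspan.
Variables (F : fieldType) (V : vectType F).
Implicit Types (S : set V) (W : {vspace V}).

Lemma vspanP S : (forall v, S v -> v \in vspan S) /\
  (forall W, (forall v, S v -> v \in W) -> (vspan S <= W)%VS).
Proof.
rewrite /vspan; case: xgetP => [W _ []//|noW]; exfalso.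
pose P n := `[< exists2 W, \dim W = n & forall v, S v -> v \in W >].
have exP : exists n, P n.
  by exists (\dim {:V}); apply/asboolP; exists fullv => // v _; rewrite memvf.
case: (ex_minnP exP) => n /asboolP [W dimW SW] minn.
apply: (noW W); split=> // W' SW'.
suff /eqP eqW : (W :&: W')%VS == W by rewrite -eqW capvSr.
rewrite eqEdim capvSl dimW; apply: minn; apply/asboolP.
by exists (W :&: W')%VS => // v Sv; rewrite memv_cap SW ?SW'.
Qed.

Lemma mem_vspan S v : S v -> v \in vspan S.
Proof. exact: (proj1 (vspanP S)). Qed.

Lemma vspan_le S W : (forall v, S v -> v \in W) -> (vspan S <= W)%VS.
Proof. exact: (proj2 (vspanP S)). Qed.

Lemma mem_vspan_submod S : S 0 ->
  (forall a u v, S u -> S v -> S (a *: u + v)) ->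
  forall v, (v \in vspan S) = `[< S v >].
Proof.
move=> S0 SP v; apply/idP/asboolP; last exact: mem_vspan.
pose P n := `[< exists2 W : {vspace V}, \dim W = n &
                forall v, v \in W -> S v >].
have exP : exists n, P n.
  exists 0; apply/asboolP; exists 0%VS; first exact: dimv0.
  by move=> w; rewrite memv0 => /eqP ->.
have leP n : P n -> (n <= \dim {:V})%N.
  by move=> /asboolP [W <- _]; rewrite dimvS ?subvf.
case: (ex_maxnP exP leP) => n /asboolP [W dimW WS] maxn vS.
apply: (WS); have: (vspan S <= W)%VS.
  apply: vspan_le => w Sw;
  have WwS u : u \in (<[w]> + W)%VS -> S u.
    by case/memv_addP => _ /vlineP [a ->] [y /WS Sy ->]; apply: SP.
  have /maxn : P (\dim (<[w]> + W)%VS) by apply/asboolP; exists (<[w]> + W)%VS.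
  rewrite -dimW => dimle; have /eqP -> : W == (<[w]> + W)%VS.
    by rewrite eqEdim addvSr.
  by rewrite (subvP (addvSl _ _)) // memv_line.
by move=> /subvP; apply.
Qed.

End Vspan.

Definition ltrace (F : fieldType) (V : vectType F) (f : V -> V) : F :=
  \sum_i coord (vbasis {:V}) i (f (vbasis {:V})`_i).

(* The set S is a basis of the whole space (its elements being listed, without
   repetition since a basis is free, by some sequence). *)
Definition set_basis (F : fieldType) (V : vectType F) (S : set V) : Prop :=
  exists2 e : seq V, (forall v, S v <-> v \in e) & basis_of {:V} e.

Definition prodv (F : fieldType) (V1 V2 : vectType F)
    (W1 : {vspace V1}) (W2 : {vspace V2}) : {vspace (V1 * V2)%type} :=
  vspan [set x : V1 * V2 | x.1 \in W1 /\ x.2 \in W2].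

Definition qspan (R : fieldType) (V : vectType R) (S : set V) : set V :=
  [set v | exists (n : nat) (c : 'I_n -> rat) (s : 'I_n -> V),
    (forall i, S (s i)) /\ v = \sum_i (ratr (c i) : R) *: s i].

Definition is_rational (R : fieldType) (V : vectType R) (Q : set V)
    (W : {vspace V}) : Prop :=
  exists2 e : seq V, basis_of W e & forall v, v \in e -> Q v.

(** * Complexification *)

(* The pair (x, y) stands for x + i y. *)
Definition cplx (V : Type) : Type := (V * V)%type.

Section Complexification.
Variables (R : rcfType) (V : vectType R).

HB.instance Definition _ := GRing.Zmodule.copy (cplx V) (V * V)%type.

Definition cplx_scale (a : R[i]) (z : cplx V) : cplx V :=
  (complex.Re a *: z.1 - complex.Im a *: z.2, complex.Re a *: z.2 + complex.Im a *: z.1).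

Fact cplx_scaleA a b z :
  cplx_scale a (cplx_scale b z) = cplx_scale (a * b) z.
Proof.
case: a b z => [a1 a2] [b1 b2] [x y]; rewrite /cplx_scale /=.
rewrite !scalerBr !scalerDr !scalerA !scalerBl !scalerDl.
by congr pair; rewrite ?opprD [X in _ + X = _]addrC addrACA.
Qed.

Fact cplx_scale1 : left_id 1 cplx_scale.
Proof. by case=> x y; rewrite /cplx_scale /= !scale1r !scale0r subr0 addr0. Qed.

Fact cplx_scaleDr : right_distributive cplx_scale +%R.
Proof.
case=> [a1 a2] [x y] [x' y']; rewrite /cplx_scale /=.
by congr pair; rewrite /= !scalerDr ?opprD addrACA.
Qed.

Fact cplx_scaleDl z : {morph cplx_scale^~ z : a b / a + b}.
Proof.
case: z => x y [a1 a2] [b1 b2]; rewrite /cplx_scale /=.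
by congr pair; rewrite /= !scalerDl ?opprD addrACA.
Qed.

HB.instance Definition _ := GRing.Zmodule_isLmodule.Build R[i] (cplx V)
  cplx_scaleA cplx_scale1 cplx_scaleDr cplx_scaleDl.

Fact cplx_vect_iso : Vector.axiom (\dim {:V}) (cplx V).
Proof.
pose b := vbasis {:V}.
exists (fun z : cplx V => \row_i (coord b i z.1 +i* coord b i z.2)%C).
  move=> [a1 a2] [x y] [x' y']; apply/rowP => i; rewrite !mxE /=.
  by apply/eqP; rewrite eq_complex /= !linearD !linearN !linearZ /= !eqxx.
exists (fun r : 'rV_(\dim {:V}) =>
  (\sum_i complex.Re (r 0 i) *: b`_i, \sum_i complex.Im (r 0 i) *: b`_i) : cplx V).
  move=> [x y]; congr pair; rewrite /=.
    by rewrite {2}(coord_vbasis (memvf x)); apply: eq_bigr => i _; rewrite mxE.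
  by rewrite {2}(coord_vbasis (memvf y)); apply: eq_bigr => i _; rewrite mxE.
move=> r; apply/rowP => i; rewrite mxE /=.
rewrite !coord_sum_free ?(basis_free (vbasisP _)) //.
by case: (r 0 i).
Qed.

HB.instance Definition _ :=
  Lmodule_hasFinDim.Build R[i] (cplx V) cplx_vect_iso.

Definition cemb (v : V) : cplx V := (v, 0).

(* W^C, for a real subspace W of V *)
Definition cplxv (W : {vspace V}) : {vspace cplx V} :=
  vspan [set z : cplx V | z.1 \in W /\ z.2 \in W].

(* W \cap V, for a complex subspace W of V^C *)
Definition real_points (W : {vspace cplx V}) : {vspace V} :=
  vspan [set v : V | cemb v \in W].

End Complexification.

(* The complex bilinear extension of a real bilinear map *)
Definition cbil (R : rcfType) (V1 V2 V3 : vectType R) (f : V1 -> V2 -> V3)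
    (x : cplx V1) (y : cplx V2) : cplx V3 :=
  (f x.1 y.1 - f x.2 y.2, f x.1 y.2 + f x.2 y.1).

(** * Lie algebras *)

Section Lie.
Variables (F : fieldType) (L : vectType F).

Definition is_lie_bracket (br : L -> L -> L) : Prop :=
  (forall x, br x x = 0) /\
  (forall x y z, br x (br y z) + br y (br z x) + br z (br x y) = 0).

Definition is_lie_action (M : vectType F) (br : L -> L -> L)
    (act : L -> M -> M) : Prop :=
  forall x y v, act (br x y) v = act x (act y v) - act y (act x v).

Definition killing (br : L -> L -> L) (x y : L) : F :=
  ltrace (fun z => br x (br y z)).

Definition subalgebra (br : L -> L -> L) (W : {vspace L}) : Prop :=
  {in W &, forall x y, br x y \in W}.

Definition submodule (M : vectType F) (act : L -> M -> M)
    (W : {vspace L}) (N : {vspace M}) : Prop :=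
  {in W & N, forall x v, act x v \in N}.

Definition abelian_subalgebra (br : L -> L -> L) (W : {vspace L}) : Prop :=
  {in W &, forall x y, br x y = 0}.

Definition maximal_abelian (br : L -> L -> L) (W : {vspace L}) : Prop :=
  abelian_subalgebra br W /\
  (forall W', abelian_subalgebra br W' -> (W <= W')%VS -> W' = W).

Definition lie_center (br : L -> L -> L) (W : {vspace L}) : {vspace L} :=
  vspan [set x | x \in W /\ {in W, forall y, br x y = 0}].

(* The linear functionals on the subspace h (and not on all of L) *)
Definition dualv (h : {vspace L}) := 'Hom(subvs_of h, F^o).

Definition weight_space (h : {vspace L}) (M : vectType F)
    (act : L -> M -> M) (mu : dualv h) : {vspace M} :=
  vspan [set v | forall H : subvs_of h, act (vsval H) v = mu H *: v].

Definition nonzero_weight (h : {vspace L}) (M : vectType F)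
    (act : L -> M -> M) (mu : dualv h) : bool :=
  (mu != 0) && (weight_space act mu != 0%VS).

End Lie.

(* A semisimple real Lie algebra is compact when its Killing form is negative
   definite, and negative definiteness implies semisimplicity. *)
Definition compact_semisimple (R : realFieldType) (L : vectType R)
    (br : L -> L -> L) : Prop :=
  forall x, x != 0 -> killing br x x < 0.

(** * Quaternions *)

(* (a, b, c, d) stands for a + b i + c j + d k. *)
Definition quaternion (R : fieldType) := (R^o * R^o * R^o * R^o)%type.

Definition qmul (R : fieldType) (x y : quaternion R) : quaternion R :=
  let: (a, b, c, d) := x in
  let: (a', b', c', d') := y in
  (a * a' - b * b' - c * c' - d * d',
   a * b' + b * a' + c * d' - d * c',
   a * c' - b * d' + c * a' + d * b',
   a * d' + b * c' - c * b' + d * a').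

Definition isomorphic_to_quaternions (R : fieldType) (L : vectType R)
    (br : L -> L -> L) (W : {vspace L}) : Prop :=
  exists f : 'Hom(L, quaternion R),
    [/\ {in W &, injective f},
        (f @: W)%VS = fullv
      & {in W &, forall x y, f (br x y) = qmul (f x) (f y) - qmul (f y) (f x)}].

(** * Left invariant metrics *)

(* The Levi-Civita connection of the left invariant metric given by ip,
   restricted to left invariant vector fields: it is torsion free, and it
   preserves ip (inner products of left invariant fields are constant). *)
Definition is_levi_civita (R : realFieldType) (L : vectType R)
    (ip : L -> L -> R) (br nabla : L -> L -> L) : Prop :=
  (forall x y, nabla x y - nabla y x = br x y) /\
  (forall x y z, ip (nabla x y) z + ip y (nabla x z) = 0).

(* Invariance of W under nabla is the Lie algebra form of the condition that
   exp(W) be a totally geodesic submanifold. By [levi_civita_unique] there is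
   at most one nabla. *)
Definition totally_geodesic (R : realFieldType) (L : vectType R)
    (ip : L -> L -> R) (br : L -> L -> L) (W : {vspace L}) : Prop :=
  exists2 nabla : {bilinear L -> L -> L}, is_levi_civita ip br nabla &
    {in W &, forall x y, nabla x y \in W}.

Lemma levi_civita_unique (R : realFieldType) (L : vectType R)
    (ip : {dot L for @idfun R}) (br D D' : L -> L -> L) :
  is_levi_civita ip br D -> is_levi_civita ip br D' -> D =2 D'.
Proof.
move=> [tD mD] [tD' mD'] x y.
pose t a b c := ip (D a b - D' a b) c.
have tC a b c : t a b c = t b a c.
  congr (ip _ c); rewrite -[D a b](subrK (D b a)) tD.
  by rewrite -[D' a b](subrK (D' b a)) tD' opprD addrACA subrr add0r.
have tN a b c : t a b c = - t a c b.
  apply/eqP; rewrite -addr_eq0 /t linearBl.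
  rewrite (hermC ip (D a c - _) b) expr0 mul1r linearBr /= addrACA -opprD.
  by rewrite mD mD' subrr.
suff t0 c : t x y c = 0.
  apply/eqP; rewrite -subr_eq0; apply: contraT => nz.
  by have := @neq0_dnorm_gt0 _ _ _ ip _ nz; rewrite -[ip _ _]/(t x y _) t0 ltxx.
have : t x y c = - t x y c by rewrite {1}tC tN (tC y c) tN opprK (tC c x) tN.
by move/eqP; rewrite -addr_eq0 -mulr2n mulrn_eq0 /= => /eqP.
Qed.

(** * The Lie algebra g_0 and its module U *)

Section Chevalley.
Variables (R : realType) (g0 U : vectType R).
Variables (br : g0 -> g0 -> g0) (act : g0 -> U -> U) (h0 : {vspace g0}).

Local Notation g := (cplx g0).
Local Notation h := (cplxv h0).
Local Notation brC := (cbil br).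
Local Notation actC := (cbil act).

Definition hdual := dualv h.

Implicit Types (alpha beta lambda mu : hdual) (Delta : seq hdual).

Definition is_root : pred hdual := nonzero_weight brC.

Definition root_space alpha : {vspace g} := weight_space brC alpha.

Definition nat_comb Delta alpha : Prop :=
  exists c : nat -> nat, alpha = \sum_(i < size Delta) Delta`_i *+ c i.

(* Freeness is over C; a base is free over R iff it is free over C. *)
Definition is_root_base Delta : Prop :=
  [/\ all is_root Delta, free Delta &
      forall alpha, is_root alpha ->
        nat_comb Delta alpha \/ nat_comb Delta (- alpha)].

Definition positive_root Delta alpha : Prop :=
  is_root alpha /\ nat_comb Delta alpha.

(* H_alpha, the Killing dual of alpha in h *)
Definition Hroot alpha : g := xget 0 [set H : g | H \in h /\
  forall H' : subvs_of h, killing brC (vsval H') H = alpha H'].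

Definition tau alpha : g :=
  (2 / killing brC (Hroot alpha) (Hroot alpha)) *: Hroot alpha.

(* i tau_alpha, as an element of g_0 *)
Definition ttau alpha : g0 := xget 0 [set x : g0 | cemb x = 'i%C *: tau alpha].

Definition g0_root alpha : {vspace g0} :=
  real_points (root_space alpha + root_space (- alpha))%VS.

Definition is_U_weight : pred hdual := nonzero_weight actC.

Definition U_weight mu : {vspace U} :=
  if mu == 0 then real_points (weight_space actC (0 : hdual))
  else if is_U_weight mu then
    real_points (weight_space actC mu + weight_space actC (- mu))%VS
  else 0%VS.

(* The compact Chevalley basis, as a subset of g; it is required in
   [chevalley_basis] to consist of elements of g_0. *)
Definition compact_basisC Delta (X : hdual -> g) : set g :=
  [set z : g |
    (exists2 alpha, alpha \in Delta & z = 'i%C *: tau alpha) \/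
    (exists2 beta, positive_root Delta beta &
      z = X beta - X (- beta) \/ z = 'i%C *: X beta + 'i%C *: X (- beta))].

Definition compact_basis Delta X : set g0 :=
  [set x : g0 | compact_basisC Delta X (cemb x)].

Definition chevalley_basis Delta (X : hdual -> g) : Prop :=
  [/\ (forall beta, is_root beta -> X beta \in root_space beta),
      set_basis [set z : g | (exists2 beta, is_root beta & z = X beta) \/
                             (exists2 alpha, alpha \in Delta & z = tau alpha)],
      (forall alpha, is_root alpha -> brC (X alpha) (X (- alpha)) = tau alpha),
      (exists C : hdual -> hdual -> R[i], forall alpha beta,
        is_root alpha -> is_root beta -> is_root (alpha + beta) ->
        brC (X alpha) (X beta) = C alpha beta *: X (alpha + beta) /\
        C alpha beta = - C (- alpha) (- beta))
    & (forall z, compact_basisC Delta X z -> exists x : g0, z = cemb x) /\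
      set_basis (compact_basis Delta X)].

(* B0 is a basis of U, it is the union of bases b mu of the subspaces U_0 and
   U_mu, and the elements of C0 preserve its rational span. *)
Definition adapted_basis (C0 : set g0) (B0 : seq U) : Prop :=
  [/\ basis_of {:U} B0,
      (exists b : hdual -> seq U,
        (forall mu, mu = 0 \/ is_U_weight mu -> basis_of (U_weight mu) (b mu)) /\
        (forall u, u \in B0 <->
          exists2 mu, mu = 0 \/ is_U_weight mu & u \in b mu))
    & forall x u, C0 x -> qspan [set` B0] u -> qspan [set` B0] (act x u)].

Definition n0_basis (C0 : set g0) (B0 : seq U) : set (U * g0) :=
  [set x | (exists2 u, u \in B0 & x = (u, 0)) \/
           (exists2 Z, C0 Z & x = (0, Z))].

Definition compatible_inner_product (C0 : set g0) (B0 : seq U)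
    (ip : U * g0 -> U * g0 -> R) : Prop :=
  [/\ (forall u Z, ip (u, 0) (0, Z) = 0),
      (forall Z u u', ip (act Z u, 0) (u', 0) = - ip (u, 0) (act Z u', 0)),
      (forall Z Z', ip (0, Z) (0, Z') = - killing br Z Z')
    & forall x y, n0_basis C0 B0 x -> n0_basis C0 B0 y ->
        exists q : rat, ip x y = ratr q].

(* The nilpotent bracket of n_0 = U (+) g_0, determined by ip and act *)
Definition is_n0_bracket (ip : U * g0 -> U * g0 -> R)
    (nbr : U * g0 -> U * g0 -> U * g0) : Prop :=
  [/\ (forall Z x, nbr (0, Z) x = 0 /\ nbr x (0, Z) = 0),
      (forall x y, (nbr x y).1 = 0)
    & forall u u' Z, ip (nbr (u, 0) (u', 0)) (0, Z) = ip (act Z u, 0) (u', 0)].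

(* The vector of h_0 dual to -i lambda; (H : g) is fed to lambda through the
   projection vsproj onto h, which fixes the elements of h. *)
Definition Htilde (ip : U * g0 -> U * g0 -> R) lambda : g0 :=
  xget 0 [set Z : g0 | Z \in h0 /\
    {in h0, forall H, ((ip (0, H) (0, Z))%:C)%C
                      = - 'i%C * lambda (vsproj h (cemb H))}].

(* The sum over all integers k of the U_(lambda + k beta) *)
Definition U_string lambda beta : {vspace U} :=
  vspan [set u | exists k : int, u \in U_weight (lambda + beta *~ k)].

Definition g_string (ip : U * g0 -> U * g0 -> R) lambda beta : {vspace g0} :=
  (g0_root beta + <[Htilde ip lambda]> + <[ttau beta]>)%VS.

End Chevalley.

(* Main.v *)
Require Import Defs.
From HB Require Import structures.
From mathcomp Require Import all_boot all_order all_algebra complex.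
From mathcomp Require Import boolp classical_sets reals.
From mathcomp Require Import ring lra.
Import Order.TTheory GRing.Theory Num.Theory.
Local Open Scope ring_scope.

Set Implicit Arguments.
Unset Strict Implicit.
Unset Printing Implicit Defensive.

(** The whole statement can be read on real data. Since g_0 acts by skew
operators on itself and on U, every root and every weight of U is imaginary on
h_0, say mu = i m with m real. Then x + i y has weight mu exactly when
H x = - m(H) y and H y = m(H) x for all H in h_0; such pairs are called [wpair].
Complex conjugation of x + i y changes m into - m, so that U_mu consists of the
real parts of the vectors of weight mu ([real_points_wpair]), and likewise
g_(0,beta). An h_0-equivariant bilinear map sends pairs for m and n to a pair
for m + n and to one for m - n, whose first components add up to twice the image
of the real parts ([wpair_mulD], [wpair_mulB]). This is used for the bracket of
g_0, for the action on U, and for the nilpotent bracket U x U -> g_0, which is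
g_0-equivariant because both inner products are invariant ([nb_derivation]).

Structure of g_(lambda,beta). The hypothesis that X_beta - X_-beta and
i X_beta + i X_-beta are real says X_beta = p + i q and X_-beta = - p + i q
([root_vector]); root spaces are lines because g has a basis of weight vectors
containing one vector per root ([root_space_line]). With tau~ the vector
i tau_beta, the vectors tau~, 2 p, - 2 q bracket like i, j, k, and the component
Z of H~_lambda orthogonal to H~_beta commutes with them and plays the role of 1.
The four vectors are nonzero and pairwise orthogonal, hence independent.

The module U'. Root vectors for beta shift the index of U_(lambda + k beta) by
one, and h_0 preserves each of these spaces ([submodule_string]).

The nilpotent algebra. For u in U_(lambda + k beta) and v in U_(lambda + j beta),
the bracket [u, v] is half the sum of a vector of weight 2 lambda + (k + j) beta,
which vanishes by hypothesis, and one of weight (k - j) beta. The latter is a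
multiple of H~_(lambda + k beta) when k = j, lies in g_(0,beta) when
k - j = 1 or - 1, and vanishes otherwise because no proper multiple of a root is a
root ([wpair_multiple]); so [U', U'] lies in g_(lambda,beta) ([nb_string]). The
Levi-Civita connection is half the bracket on U x U and minus half the action on
U x g_0, so it preserves U' + g_(lambda,beta). The U-part of a central vector is
killed by Z, and Z squares to a negative scalar on U', as beta vanishes on Z
([string_center_inj]); hence the center is g_(lambda,beta).

Rationality. The dual vector H~_alpha of a simple root is a rational multiple of
i tau_alpha, because the square length of i tau_alpha is rational; summing,
H~_beta is rational. For H~_lambda only the line matters. Write lambda = i m: on
a vector of B_0 in U_lambda the product of two simple coroots acts by
- m(i tau_alpha) m(i tau_alpha'), so these products are rational, and a suitable
multiple of H~_lambda has rational inner products with all i tau_alpha. As their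
Gram matrix is rational, it is a rational combination of them ([qspan_gram]).
Finally U' is spanned by the vectors of B_0 that it contains. *)

(** * Inner products *)

Definition inner_product (R : realFieldType) (V : lmodType R)
    (b : V -> V -> R) : Prop :=
  [/\ forall a x y z, b (a *: x + y) z = a * b x z + b y z,
      forall x y, b x y = b y x & forall x, x != 0 -> 0 < b x x].

Section InnerProduct.
Variables (R : realFieldType) (V : lmodType R) (b : V -> V -> R).
Hypothesis bP : inner_product b.

Lemma innerC x y : b x y = b y x. Proof. by case: bP => _ ->. Qed.

Lemma innerDl x y z : b (x + y) z = b x z + b y z.
Proof. by case: bP => /(_ 1 x y z); rewrite scale1r mul1r. Qed.

Lemma inner0l z : b 0 z = 0.
Proof. by apply: (@addrI _ (b 0 z)); rewrite -innerDl !addr0. Qed.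

Lemma innerZl a x z : b (a *: x) z = a * b x z.
Proof. by case: bP => /(_ a x 0 z); rewrite addr0 inner0l addr0. Qed.

Lemma innerNl x z : b (- x) z = - b x z.
Proof. by rewrite -scaleN1r innerZl mulN1r. Qed.

Lemma innerBl x y z : b (x - y) z = b x z - b y z.
Proof. by rewrite innerDl innerNl. Qed.

Lemma inner0r z : b z 0 = 0. Proof. by rewrite innerC inner0l. Qed.

Lemma innerDr z x y : b z (x + y) = b z x + b z y.
Proof. by rewrite !(innerC z) innerDl. Qed.

Lemma innerZr a z x : b z (a *: x) = a * b z x.
Proof. by rewrite !(innerC z) innerZl. Qed.

Lemma innerNr z x : b z (- x) = - b z x.
Proof. by rewrite !(innerC z) innerNl. Qed.

Lemma innerBr z x y : b z (x - y) = b z x - b z y.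
Proof. by rewrite innerDr innerNr. Qed.

Lemma inner_suml I (r : seq I) (P : pred I) (F : I -> V) z :
  b (\sum_(i <- r | P i) F i) z = \sum_(i <- r | P i) b (F i) z.
Proof. by apply: (big_morph (b^~ z)) => [x y|]; rewrite ?innerDl ?inner0l. Qed.

Lemma inner_sumr I (r : seq I) (P : pred I) (F : I -> V) z :
  b z (\sum_(i <- r | P i) F i) = \sum_(i <- r | P i) b z (F i).
Proof. by rewrite innerC inner_suml; apply: eq_bigr => i _; rewrite innerC. Qed.

Lemma inner_gt0 x : x != 0 -> 0 < b x x.
Proof. by case: bP => _ _; apply. Qed.

Lemma inner_ge0 x : 0 <= b x x.
Proof. by have [->|/inner_gt0/ltW//] := eqVneq x 0; rewrite inner0l. Qed.

Lemma inner_eq0 x : b x x = 0 -> x = 0.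
Proof.
by move=> x0; apply/eqP; apply: contraT => /inner_gt0; rewrite x0 ltxx.
Qed.

Lemma inner_add_eq0 x y : b x x + b y y = 0 -> x = 0 /\ y = 0.
Proof.
by move=> xy0; have := inner_ge0 x; have := inner_ge0 y => y0 x0;
  split; apply: inner_eq0; lra.
Qed.

End InnerProduct.

(** The coordinates of T solve a linear system whose matrix is the Gram matrix
    of a basis of W; it is invertible, because a vector of W orthogonal to that
    basis is orthogonal to itself. *)
Lemma riesz (R : realFieldType) (V : vectType R) (b : V -> V -> R)
    (W : {vspace V}) (m : V -> R) : inner_product b ->
  (forall a x y, x \in W -> y \in W -> m (a *: x + y) = a * m x + m y) ->
  exists2 T, T \in W & {in W, forall H, b H T = m H}.
Proof.
move=> bP mP; pose e := vbasis W; pose n := \dim W.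
have eW i : (i < n)%N -> e`_i \in W.
  by move=> ltin; apply/vbasis_mem/mem_nth; rewrite size_tuple.
have m0 : m 0 = 0.
  have := mP 1 0 0 (mem0v _) (mem0v _); rewrite scale1r addr0 mul1r => h.
  by apply: (@addrI _ (m 0)); rewrite -h addr0.
have msum (c : 'I_n -> R) (r : seq 'I_n) :
    m (\sum_(i <- r) c i *: e`_i) = \sum_(i <- r) c i * m e`_i.
  elim: r => [|i r IH]; rewrite ?big_nil // !big_cons mP ?IH ?eW //.
  by apply: memv_suml => j _; rewrite memvZ ?eW.
pose G := \matrix_(i < n, j < n) b e`_i e`_j.
have bG (v : 'rV_n) (j : 'I_n) : b (\sum_i v 0 i *: e`_i) e`_j = (v *m G) 0 j.
  rewrite inner_suml // mxE; apply: eq_bigr => i _.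
  by rewrite (innerZl bP) !mxE.
have Gu : G \in unitmx.
  rewrite -row_free_unit -kermx_eq0; apply/rowV0P => v /sub_kermxP vG.
  have x0 : \sum_(i < n) v 0 i *: e`_i = 0.
    apply: (inner_eq0 bP); rewrite (inner_sumr bP) big1 // => j _.
    by rewrite (innerZr bP) bG vG mxE mulr0.
  apply/rowP => i; rewrite mxE.
  have := basis_free (vbasisP W); move/freeP => /(_ (fun i => v 0 i)).
  exact.
pose t := \row_i m e`_i *m invmx G.
exists (\sum_i t 0 i *: e`_i).
  by apply: memv_suml => i _; rewrite memvZ ?eW.
move=> H HW; rewrite (coord_vbasis HW) msum (inner_suml bP).
by apply: eq_bigr => i _; rewrite (innerZl bP) (innerC bP) bG mulmxKV // mxE.
Qed.

Lemma inner_orthogonal_free (R : realFieldType) (V : vectType R)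
    (b : V -> V -> R) (e : seq V) : inner_product b ->
  0 \notin e -> pairwise (fun x y => b x y == 0) e -> free e.
Proof.
move=> bP; elim: e => [|v e IH]; first by rewrite nil_free.
rewrite inE negb_or eq_sym => /andP[v0 e0] /= /andP[/allP ve pe].
rewrite free_cons IH // andbT; apply: contra v0 => vs.
have vE := coord_span (X := in_tuple e) vs.
apply/eqP/(inner_eq0 bP); rewrite {2}vE (inner_sumr bP) big1 // => i _.
by rewrite (innerZr bP) (eqP (ve _ _)) ?mulr0 ?mem_nth.
Qed.

Lemma mem_addvl (F : fieldType) (V : vectType F) (A B : {vspace V}) x :
  x \in A -> x \in (A + B)%VS.
Proof. by apply/subvP/addvSl. Qed.

Lemma mem_addvr (F : fieldType) (V : vectType F) (A B : {vspace V}) x :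
  x \in B -> x \in (A + B)%VS.
Proof. by apply/subvP/addvSr. Qed.

Lemma half_sum (R : numFieldType) (V : lmodType R) (x y : V) :
  x = 2^-1 *: ((x - y) + (x + y)).
Proof.
by rewrite addrCA subrK -mulr2n -scaler_nat scalerA mulVf ?scale1r ?pnatr_eq0.
Qed.

(** * Traces *)

Lemma linear_combP (F : fieldType) (V V' : vectType F) (f : V -> V') :
  linear f -> forall n (c : 'I_n -> F) (x : 'I_n -> V),
  f (\sum_i c i *: x i) = \sum_i c i *: f (x i).
Proof.
move=> fP n c x; have f0 : f 0 = 0.
  have := fP (-1) 0 0; rewrite scaler0 add0r scaleN1r addNr //.
rewrite -!(big_enum _ _ predT) /=.
elim: (enum _) => [|i s IH]; first by rewrite !big_nil.
by rewrite !big_cons fP IH.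
Qed.

Section Trace.
Variables (F : fieldType) (V : vectType F).
Implicit Types f g : V -> V.

Lemma linear_morphs f : linear f ->
  [/\ {morph f : x y / x + y}, {morph f : x y / x - y}
    & forall a, {morph f : x / a *: x}].
Proof.
move=> fP; have fD : {morph f : x y / x + y}.
  by move=> x y; rewrite -[x in LHS]scale1r fP scale1r.
have f0 : f 0 = 0 by apply: (@addrI _ (f 0)); rewrite -fD !addr0.
have fZ a : {morph f : x / a *: x}.
  by move=> x; rewrite -[a *: x in LHS]addr0 fP f0 addr0.
by split=> // x y; rewrite fD -scaleN1r fZ scaleN1r.
Qed.

(** A trace defined on one chosen basis can be computed on any other one; this
    lets the trace on a complexification be read on a basis of real vectors. *)
Lemma ltrace_basis f n (e : n.-tuple V) : linear f -> basis_of {:V} e ->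
  ltrace f = \sum_i coord e i (f e`_i).
Proof.
move=> fP eb; rewrite /ltrace; set b := vbasis _.
have be := coord_basis eb.
transitivity (\sum_(i < \dim {:V}) \sum_(j < n) coord e j b`_i * coord b i (f e`_j)).
  apply: eq_bigr => i _; rewrite {1}[b`_i]be ?memvf //.
  rewrite (linear_combP fP) linear_sum /=.
  by apply: eq_bigr => j _; rewrite linearZ.
rewrite exchange_big; apply: eq_bigr => j _ /=.
rewrite {2}[f e`_j](coord_vbasis (memvf _)) -/b linear_sum /=.
by apply: eq_bigr => i _; rewrite linearZ mulrC.
Qed.

Lemma ltraceC f g : linear f -> linear g -> ltrace (f \o g) = ltrace (g \o f).
Proof.
move=> fP gP; rewrite /ltrace; set b := vbasis _ => /=.
transitivity (\sum_(i < \dim {:V}) \sum_(j < \dim {:V})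
    coord b j (g b`_i) * coord b i (f b`_j)).
  apply: eq_bigr => i _; rewrite {1}[g b`_i](coord_vbasis (memvf _)).
  rewrite (linear_combP fP) linear_sum /=.
  by apply: eq_bigr => j _; rewrite linearZ.
rewrite exchange_big; apply: eq_bigr => j _ /=.
rewrite [f b`_j](coord_vbasis (memvf _)) (linear_combP gP) linear_sum /=.
by apply: eq_bigr => i _; rewrite linearZ -coord_vbasis ?memvf //= mulrC.
Qed.

Lemma eq_ltrace f g : f =1 g -> ltrace f = ltrace g.
Proof. by move=> fg; apply: eq_bigr => i _; rewrite fg. Qed.

Lemma ltraceB f g : ltrace (fun x => f x - g x) = ltrace f - ltrace g.
Proof. by rewrite -sumrB; apply: eq_bigr => i _; rewrite linearB. Qed.

Lemma ltraceD f g : ltrace (fun x => f x + g x) = ltrace f + ltrace g.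
Proof. by rewrite -big_split; apply: eq_bigr => i _; rewrite linearD. Qed.

End Trace.

Section CplxTrace.
Variables (R : rcfType) (V : vectType R).

Lemma cplx_dim : \dim {:cplx V} = \dim {:V}. Proof. exact: dimvf. Qed.

Lemma cplx_scaleE (a : R[i]) (z : cplx V) : a *: z =
  (complex.Re a *: z.1 - complex.Im a *: z.2,
   complex.Re a *: z.2 + complex.Im a *: z.1).
Proof. by []. Qed.

Lemma cplx_sumE I (r : seq I) (P : pred I) (F : I -> cplx V) :
  \sum_(i <- r | P i) F i =
  (\sum_(i <- r | P i) (F i).1, \sum_(i <- r | P i) (F i).2).
Proof.
by elim/big_rec3: _ => // i x y z _ ->.
Qed.

Lemma cemb_basis n (e : n.-tuple V) : basis_of {:V} e ->
  basis_of {:cplx V} [tuple of map (@cemb R V) e].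
Proof.
move=> eb; have [esp ef] := andP eb; rewrite basisEfree.
have sz : n = \dim {:V}.
  by rewrite -(eqP esp); move: ef; rewrite /free => /eqP ->; rewrite size_tuple.
apply/and3P; split; rewrite ?subvf //; last first.
  by rewrite cplx_dim -sz /= size_map size_tuple.
apply/freeP => c; rewrite cplx_sumE => -[]/=.
under eq_bigr do rewrite (nth_map 0) ?size_tuple //= scaler0 subr0.
move=> e1; under eq_bigr do rewrite (nth_map 0) ?size_tuple //= scaler0 add0r.
move=> e2 i; have := elimT freeP ef.
move=> ff; apply/eqP; rewrite eq_complex.
by rewrite (ff _ e1) (ff _ e2) !eqxx.
Qed.

(** The complex linear operator f1 + i f2 on V^C. *)
Definition cplx_ext (f1 f2 : V -> V) (z : cplx V) : cplx V :=
  (f1 z.1 - f2 z.2, f1 z.2 + f2 z.1).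

Lemma linear_cplx_ext f1 f2 : linear f1 -> linear f2 ->
  linear (cplx_ext f1 f2).
Proof.
move=> l1 l2 [a1 a2] [x y] [x' y']; rewrite cplx_scaleE /cplx_ext /=.
have [D1 B1 Z1] := linear_morphs l1; have [D2 B2 Z2] := linear_morphs l2.
rewrite ![f1 (_ + _ + _)]D1 ![f2 (_ + _ + _)]D2.
rewrite [f1 (_ - _)]B1 [f1 (_ + _)]D1 [f2 (_ - _)]B2 [f2 (_ + _)]D2 !Z1 !Z2.
rewrite [in RHS]cplx_scaleE /=; congr pair => /=.
  rewrite !opprD !scalerBr !scalerDr opprD.
  by rewrite [LHS](AC (3*3) ((1*4)*(2*5)*(3*6))).
rewrite !scalerDr !scalerN.
by rewrite [LHS](AC (3*3) ((1*4)*(2*5)*(3*6))).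
Qed.

Lemma ltrace_cplx_ext f1 f2 : linear f1 -> linear f2 ->
  ltrace (cplx_ext f1 f2) = (ltrace f1 +i* ltrace f2)%C.
Proof.
move=> l1 l2; pose b := vbasis {:V}; pose n := \dim {:V}.
have bb := vbasisP {:V}.
have f0 (f : V -> V) : linear f -> f 0 = 0.
  by case/linear_morphs=> fD _ _; apply: (@addrI _ (f 0)); rewrite -fD !addr0.
rewrite (ltrace_basis (linear_cplx_ext l1 l2) (cemb_basis bb)) -/b.
transitivity (\sum_(i < n) (coord b i (f1 b`_i) +i* coord b i (f2 b`_i))%C).
  apply: eq_bigr => i _; set v := cplx_ext _ _ _.
  have -> : v = \sum_(j < n) (coord b j (f1 b`_i) +i* coord b j (f2 b`_i))%C
                 *: [tuple of map (@cemb R V) b]`_j.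
    rewrite /v cplx_sumE /= (nth_map 0) ?size_tuple //=; congr pair => /=.
      rewrite f0 // subr0 [LHS](coord_vbasis (memvf _)); apply: eq_bigr => j _.
      by rewrite (nth_map 0) ?size_tuple //= scaler0 subr0.
    rewrite f0 // add0r [LHS](coord_vbasis (memvf _)); apply: eq_bigr => j _.
    by rewrite (nth_map 0) ?size_tuple //= scaler0 add0r.
  rewrite coord_sum_free //.
  by have [] := andP (cemb_basis bb).
rewrite /ltrace; apply/eqP; rewrite eq_complex !raddf_sum /= !eqxx //.
Qed.

End CplxTrace.

(** * The Killing form *)

Section Killing.
Variables (F : fieldType) (L : vectType F) (br : {bilinear L -> L -> L}).
Hypothesis lie : is_lie_bracket br.

Lemma lie_anti x y : br x y = - br y x.
Proof.
have [brxx _] := lie; apply/eqP; rewrite -addr_eq0; apply/eqP.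
by have := brxx (x + y); rewrite linearDl !linearDr /= !brxx addr0 add0r.
Qed.

Lemma lie_leibniz x y z : br x (br y z) = br (br x y) z + br y (br x z).
Proof.
have [_ /(_ x y z) jac] := lie; apply/eqP; rewrite -subr_eq0 -[0 in X in _ == X]jac.
rewrite opprD addrA (lie_anti z (br x y)) (lie_anti z x) linearNr /=.
by rewrite addrAC.
Qed.

Lemma ad_linear x : linear (br x).
Proof. by move=> a u v; rewrite linearPr. Qed.

Lemma ad2_linear x y : linear (fun z => br x (br y z)).
Proof. by move=> a u v; rewrite !linearPr. Qed.

(** Written with ad z, ad x, ad y, the two sides differ by the trace of the
    commutator of ad z and ad x ad y. *)
Lemma killing_inv z x y : killing br (br z x) y = - killing br x (br z y).
Proof.
apply/eqP; rewrite -addr_eq0 /killing.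
have -> : ltrace (fun u => br (br z x) (br y u)) =
    ltrace (fun u => br z (br x (br y u))) - ltrace (fun u => br x (br z (br y u))).
  rewrite -ltraceB; apply: eq_ltrace => u.
  by rewrite [br z (br x _)]lie_leibniz addrK.
have -> : ltrace (fun u => br x (br (br z y) u)) =
    ltrace (fun u => br x (br z (br y u))) - ltrace (fun u => br x (br y (br z u))).
  rewrite -ltraceB; apply: eq_ltrace => u.
  by rewrite [br z (br y _)]lie_leibniz [br x (_ + _)]linearDr addrK.
rewrite addrA subrK subr_eq0; apply/eqP.
exact: (ltraceC (ad_linear z) (ad2_linear x y)).
Qed.

End Killing.

Lemma killing_cplx (R : rcfType) (L : vectType R) (br : {bilinear L -> L -> L})
    (x y : cplx L) :
  killing (cbil br) x y =
  ((killing br x.1 y.1 - killing br x.2 y.2) +i*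
   (killing br x.1 y.2 + killing br x.2 y.1))%C.
Proof.
pose f1 z := br x.1 (br y.1 z) - br x.2 (br y.2 z).
pose f2 z := br x.1 (br y.2 z) + br x.2 (br y.1 z).
have l1 : linear f1.
  move=> a u v; rewrite /f1 !linearPr /= scalerBr opprD.
  by rewrite [LHS](AC (2*2) (1*3*(2*4))).
have l2 : linear f2.
  move=> a u v; rewrite /f2 !linearPr /= scalerDr.
  by rewrite [LHS](AC (2*2) (1*3*(2*4))).
rewrite /killing -ltraceB -ltraceD -(ltrace_cplx_ext l1 l2).
apply: eq_ltrace => z; rewrite /cbil /cplx_ext /f1 /f2 /=.
congr pair; rewrite !linearDr !linearNr /= ?opprD.
  by rewrite [LHS](AC (2*2) (1*4*(2*3))) .
by rewrite [LHS](AC (2*2) (1*4*(2*3))).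
Qed.

(** * Weights in real form *)

Section RealForm.
Variables (R : rcfType) (V : vectType R).

Lemma mem_cplxv (W : {vspace V}) (z : cplx V) :
  (z \in cplxv W) = (z.1 \in W) && (z.2 \in W).
Proof.
rewrite /cplxv mem_vspan_submod => [||a u v [u1 u2] [v1 v2]] /=.
- by apply/asboolP/andP.
- by rewrite !mem0v.
- by split; rewrite !(rpredD, rpredN, rpredZ).
Qed.

Lemma mem_real_points (W : {vspace cplx V}) (v : V) :
  (v \in real_points W) = (cemb v \in W).
Proof.
rewrite /real_points mem_vspan_submod => [||a u w uW wW] /=.
- by apply/asboolP/idP.
- exact: mem0v.
- suff -> : cemb (a *: u + w) = (a%:C)%C *: cemb u + cemb w.
    by rewrite memvD ?memvZ.
  rewrite /cemb cplx_scaleE /=; congr pair; rewrite /= !(scaler0, scale0r).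
    by rewrite subr0.
  by rewrite !addr0.
Qed.

End RealForm.

Section Weights.
Variables (R : rcfType) (g0 : vectType R) (h0 : {vspace g0}).
Local Notation hd := (dualv (cplxv h0)).
Implicit Types (mu nu : hd) (H : g0).

(** The functionals live on the subspace h of g; here they are evaluated on the
    real vectors of h_0, which determine them. *)
Definition wt mu H : R[i] := mu (vsproj (cplxv h0) (cemb H)).
(** The real functional - i mu, for mu imaginary on h_0. *)
Definition rwt mu H : R := complex.Im (wt mu H).
Definition imag mu : Prop := {in h0, forall H, complex.Re (wt mu H) = 0}.

Lemma wtD mu nu H : wt (mu + nu) H = wt mu H + wt nu H.
Proof. by rewrite /wt lfunE. Qed.

Lemma wtN mu H : wt (- mu) H = - wt mu H.
Proof. by rewrite /wt opp_lfunE. Qed.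

Lemma wt0 H : wt 0 H = 0.
Proof. by rewrite /wt zero_lfunE. Qed.

Lemma wtMn mu H n : wt (mu *+ n) H = wt mu H *+ n.
Proof. by elim: n => [|n IH]; rewrite ?mulr0n ?wt0 // !mulrS wtD IH. Qed.

Lemma wtMz mu H k : wt (mu *~ k) H = wt mu H *~ k.
Proof.
case: k => n; first by rewrite -!pmulrn wtMn.
by rewrite NegzE !mulrNz -!pmulrn wtN wtMn.
Qed.

Lemma cemb_h H : H \in h0 -> cemb H \in cplxv h0.
Proof. by move=> Hh; rewrite mem_cplxv /= Hh mem0v. Qed.

Lemma wt_split mu (z : subvs_of (cplxv h0)) :
  mu z = wt mu (vsval z).1 + 'i%C * wt mu (vsval z).2.
Proof.
have := subvsP z; rewrite mem_cplxv => /andP[z1 z2].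
suff {1}-> : z = vsproj (cplxv h0) (cemb (vsval z).1) +
    'i%C *: vsproj (cplxv h0) (cemb (vsval z).2) by rewrite linearD linearZ.
apply: val_inj; rewrite /= !vsprojK ?cemb_h //; case: (vsval z) => x y.
rewrite cplx_scaleE /=; congr pair;
  by rewrite /= !(scaler0, scale0r, scale1r, subr0, add0r, addr0).
Qed.

Lemma wt_inj mu nu : {in h0, forall H, wt mu H = wt nu H} -> mu = nu.
Proof.
move=> eqmn; apply/lfunP => z; rewrite !wt_split.
by have := subvsP z; rewrite mem_cplxv => /andP[z1 z2]; rewrite !eqmn.
Qed.

Lemma wt_linear mu a H H' : H \in h0 -> H' \in h0 ->
  wt mu (a *: H + H') = (a%:C)%C * wt mu H + wt mu H'.
Proof.
move=> Hh Hh'; rewrite /wt -[RHS](linearP mu); congr (mu _).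
rewrite -linearP; congr (vsproj _ _); rewrite cplx_scaleE /cemb.
by congr pair; rewrite /= !(scaler0, scale0r, subr0, addr0).
Qed.

Lemma rwtD mu nu H : rwt (mu + nu) H = rwt mu H + rwt nu H.
Proof. by rewrite /rwt wtD raddfD. Qed.

Lemma rwtN mu H : rwt (- mu) H = - rwt mu H.
Proof. by rewrite /rwt wtN raddfN. Qed.

Lemma rwt0 H : rwt 0 H = 0.
Proof. by rewrite /rwt wt0. Qed.

Lemma rwtMz mu H k : rwt (mu *~ k) H = k%:~R * rwt mu H.
Proof. by rewrite /rwt wtMz raddfMz mulrzl. Qed.

Lemma rwtMn mu H n : rwt (mu *+ n) H = n%:R * rwt mu H.
Proof. by rewrite /rwt wtMn raddfMn mulr_natl. Qed.

Lemma rwt_linear mu a H H' : H \in h0 -> H' \in h0 ->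
  rwt mu (a *: H + H') = a * rwt mu H + rwt mu H'.
Proof.
move=> Hh Hh'; rewrite /rwt wt_linear // raddfD /=.
by case: (wt mu H) => u v /=; rewrite mul0r addr0.
Qed.

Lemma imagD mu nu : imag mu -> imag nu -> imag (mu + nu).
Proof. by move=> im iN H Hh; rewrite wtD raddfD /= im ?iN ?addr0. Qed.

Lemma imagN mu : imag mu -> imag (- mu).
Proof. by move=> im H Hh; rewrite wtN raddfN /= im ?oppr0. Qed.

Lemma imagMz mu k : imag mu -> imag (mu *~ k).
Proof. by move=> im H Hh; rewrite wtMz raddfMz /= im ?mul0rz. Qed.

Lemma imagMn mu n : imag mu -> imag (mu *+ n).
Proof. by move=> im H Hh; rewrite wtMn raddfMn /= im ?mul0rn. Qed.

Lemma wt_imag mu H : imag mu -> H \in h0 -> wt mu H = (0 +i* rwt mu H)%C.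
Proof.
move=> /(_ H) + Hh; rewrite /rwt => /(_ Hh).
by case: (wt mu H) => a b /= ->.
Qed.

Lemma rwt_inj mu nu : imag mu -> imag nu ->
  {in h0, forall H, rwt mu H = rwt nu H} -> mu = nu.
Proof. by move=> im iN e; apply: wt_inj => H Hh; rewrite !wt_imag ?e. Qed.

(** The real and imaginary parts of the equation H (x + i y) = i m(H) (x + i y),
    for H in h_0. *)
Definition wpair (M : vectType R) (act : g0 -> M -> M) (m : g0 -> R)
    (x y : M) :=
  {in h0, forall H, act H x = - (m H *: y) /\ act H y = m H *: x}.

Section Action.
Variables (M : vectType R) (act : {bilinear g0 -> M -> M}).
Implicit Types (x y u : M) (z : cplx M).

Lemma cbil_cemb H z : cbil act (cemb H) z = (act H z.1, act H z.2).
Proof. by rewrite /cbil /= !linear0l subr0 addr0. Qed.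

Lemma weight_spaceP mu z : (z \in weight_space (cbil act) mu) <->
  {in h0, forall H, cbil act (cemb H) z = wt mu H *: z}.
Proof.
rewrite /weight_space mem_vspan_submod; last 2 first.
- by move=> H; rewrite scaler0 /cbil !linear0r subr0 addr0.
- move=> a u v ueq veq H; rewrite scalerDr scalerA mulrC -scalerA -ueq -veq.
  rewrite /cbil /= !cplx_scaleE /=; case: (vsval H) => p q /=.
  rewrite !linearDr !linearNr !linearZr_LR /=.
  congr pair => /=; rewrite ?opprD !scalerDr !scalerN ?opprD;
    by rewrite [LHS](AC (3*3) ((1*4)*(2*5)*(3*6))).
split=> [/asboolP zw H Hh|zw].
  have /= <- := zw (vsproj _ (cemb H)); first by rewrite vsprojK ?cemb_h.
apply/asboolP => H; have := subvsP H; rewrite mem_cplxv => /andP[h1 h2].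
have := zw _ h1; have := zw _ h2; rewrite !cbil_cemb wt_split scalerDl -scalerA.
move=> <- <-; rewrite cplx_scaleE /cbil; congr pair => /=.
  by rewrite scale0r scale1r sub0r.
by rewrite scale0r scale1r add0r.
Qed.

Lemma weight_space_wpair mu x y : imag mu ->
  (((x, y) : cplx M) \in weight_space (cbil act) mu) <-> wpair act (rwt mu) x y.
Proof.
move=> im; rewrite weight_spaceP; split=> xy H Hh.
  have := xy H Hh; rewrite cbil_cemb /= (wt_imag im Hh) cplx_scaleE /=.
  by rewrite !scale0r sub0r add0r => -[-> ->].
have [e1 e2] := xy H Hh; rewrite cbil_cemb /= (wt_imag im Hh) cplx_scaleE /=.
by rewrite !scale0r sub0r add0r e1 e2.
Qed.

Lemma eq_wpair m m' x y : {in h0, m =1 m'} ->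
  wpair act m x y -> wpair act m' x y.
Proof. by move=> e xy H Hh; have := xy H Hh; rewrite e. Qed.

Lemma wpair_conj m x y :
  wpair act m x y -> wpair act (fun H => - m H) x (- y).
Proof.
move=> xy H Hh; have [e1 e2] := xy H Hh.
by rewrite linearNr scalerN scaleNr opprK e1 e2 scaleNr.
Qed.

(** Multiplication by i. *)
Lemma wpair_rot m x y : wpair act m x y -> wpair act m (- y) x.
Proof.
by move=> xy H Hh; have [e1 e2] := xy H Hh; rewrite linearNr e1 e2 scalerN.
Qed.

Lemma wpair0 m : wpair act m 0 0.
Proof. by move=> H Hh; rewrite linear0r scaler0 oppr0. Qed.

Lemma wpair_lin m a x y x' y' : wpair act m x y -> wpair act m x' y' ->
  wpair act m (a *: x + x') (a *: y + y').
Proof.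
move=> xy xy' H Hh; have [e1 e2] := xy H Hh; have [e1' e2'] := xy' H Hh.
rewrite !linearPr /= e1 e2 e1' e2' !scalerDr !opprD scalerN.
by rewrite ![a *: (m H *: _)]scalerA ![a * m H]mulrC -!scalerA.
Qed.

(** A real vector cannot have a nonzero imaginary weight. *)
Lemma wpair_rwt_eq0 mu x y : imag mu -> mu != 0 -> wpair act (rwt mu) x y ->
  x = 0 <-> y = 0.
Proof.
move=> im mu0 xy.
have [H Hh mH] : exists2 H, H \in h0 & rwt mu H != 0.
  apply: contrapT => noH; move/eqP: mu0; apply; apply: rwt_inj => //.
    by move=> H Hh; rewrite wt0.
  move=> H Hh; rewrite rwt0; apply/eqP/negPn/negP => mH; apply: noH.
  by exists H.
have [e1 e2] := xy H Hh; split=> e; subst.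
  move/eqP: e1; rewrite linear0r eq_sym oppr_eq0 scaler_eq0 (negPf mH).
  exact: eqP.
move/eqP: e2; rewrite linear0r eq_sym scaler_eq0 (negPf mH).
exact: eqP.
Qed.

Lemma nonzero_weight_wpair mu : imag mu -> nonzero_weight (cbil act) mu ->
  exists x y, wpair act (rwt mu) x y /\ x != 0.
Proof.
move=> im /andP[mu0 V0].
have := memv_pick (weight_space (cbil act) mu); set z := vpick _ => zV.
have z0 : z != 0 by rewrite vpick0.
case: z zV z0 => x y /(weight_space_wpair _ _ im) xy z0.
exists x, y; split=> //; apply: contra z0 => /eqP x0.
by have [/(_ x0) y0 _] := wpair_rwt_eq0 im mu0 xy; rewrite x0 y0.
Qed.

Lemma wpair_not_weight mu x y : imag mu -> mu != 0 ->
  ~~ nonzero_weight (cbil act) mu -> wpair act (rwt mu) x y -> x = 0.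
Proof.
move=> im mu0; rewrite /nonzero_weight mu0 negbK => /eqP V0.
move=> /(weight_space_wpair _ _ im); rewrite V0 memv0 => /eqP e.
by move: (congr1 fst e).
Qed.

(** If u = v + v' is real, with v of weight mu and v' of weight - mu, then v plus
    the conjugate of v' has weight mu and real part u. Conversely, half of
    (u + i y) + (u - i y) is u. *)
Lemma real_points_wpair mu u : imag mu ->
  (u \in real_points (weight_space (cbil act) mu +
                     weight_space (cbil act) (- mu)))%VS <->
  exists y, wpair act (rwt mu) u y.
Proof.
move=> im; have iN := imagN im; rewrite mem_real_points.
have negneg H : - rwt (- mu) H = rwt mu H by rewrite rwtN opprK.
split=> [/memv_addP[[x y] xy [[x' y'] xy' /= e]]|[y uy]].
  move/(weight_space_wpair _ _ im): xy => xy.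
  move/(weight_space_wpair _ _ iN): xy' => /wpair_conj.
  move=> xyc; have {xyc} xy' : wpair act (rwt mu) x' (- y').
    by apply: eq_wpair xyc => H _; exact: negneg.
  have := wpair_lin 1 xy xy'; rewrite !scale1r.
  have -> : u = x + x' by rewrite -[LHS]/(cemb u).1 e.
  by exists (y - y').
have -> : cemb u =
    2^-1%:C%C *: ((u, y) : cplx M) + 2^-1%:C%C *: ((u, - y) : cplx M).
  rewrite -scalerDr cplx_scaleE /= subrr !scale0r !scaler0 subr0 addr0.
  by rewrite -mulr2n -scaler_nat scalerA mulVf ?pnatr_eq0 // scale1r.
apply: memv_add; apply: memvZ; first by apply/weight_space_wpair.
apply/weight_space_wpair => //; apply: eq_wpair (wpair_conj uy) => H Hh.
by rewrite rwtN.
Qed.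

(** A skew operator has imaginary eigenvalues: if
    H (x + i y) = (a + i c) (x + i y), pairing the real part with x and the imaginary part with y, then adding,
    gives a (|x|^2 + |y|^2) = 0. *)
Lemma weight_imag (b : M -> M -> R) mu : inner_product b ->
  {in h0, forall H x y, b (act H x) y = - b x (act H y)} ->
  nonzero_weight (cbil act) mu -> imag mu.
Proof.
move=> bP sk /andP[mu0 V0] H Hh.
have := memv_pick (weight_space (cbil act) mu); set z := vpick _ => zV.
have z0 : z != 0 by rewrite vpick0.
move/weight_spaceP: zV => /(_ H Hh); rewrite cbil_cemb cplx_scaleE.
case: z z0 (wt mu H) => x y z0 [a c] /= [ex ey].
have sx : b (act H x) x = 0 by have := sk H Hh x x; rewrite (innerC bP x); lra.
have sy : b (act H y) y = 0 by have := sk H Hh y y; rewrite (innerC bP y); lra.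
move: sx sy; rewrite ex ey (innerBl bP) (innerDl bP) !(innerZl bP) (innerC bP y x).
move=> sx sy; have : a * (b x x + b y y) = 0 by lra.
move/eqP; rewrite mulf_eq0 => /orP[/eqP//|/eqP /(inner_add_eq0 bP)[x0 y0]].
by rewrite x0 y0 eqxx in z0.
Qed.

End Action.

Section Equivariant.
Variables (M1 M2 M3 : vectType R).
Variables (act1 : {bilinear g0 -> M1 -> M1}) (act2 : {bilinear g0 -> M2 -> M2}).
Variables (act3 : {bilinear g0 -> M3 -> M3}) (f : {bilinear M1 -> M2 -> M3}).
Hypothesis fP : {in h0, forall H x y,
  act3 H (f x y) = f (act1 H x) y + f x (act2 H y)}.
Variables (m n : g0 -> R) (x y : M1) (x' y' : M2).
Hypotheses (xy : wpair act1 m x y) (xy' : wpair act2 n x' y').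

(** The complex bilinear extension of f adds weights. *)
Lemma wpair_mulD : wpair act3 (fun H => m H + n H)
  (f x x' - f y y') (f x y' + f y x').
Proof.
move=> H Hh; have [e1 e2] := xy Hh; have [e1' e2'] := xy' Hh.
rewrite linearDr linearNr linearDr /= !fP // e1 e2 e1' e2'.
rewrite !linearNr !linearNl !linearZr_LR !linearZl_LR /= !scalerDl !scalerDr.
rewrite !scalerN !opprD; split; by rewrite [LHS](AC (2*2) ((3*1)*(2*4))).
Qed.

(** The same with x' + i y' replaced by its conjugate; twice f x x' is the sum of
    the first components of both pairs. *)
Lemma wpair_mulB : wpair act3 (fun H => m H - n H)
  (f x x' + f y y') (f y x' - f x y').
Proof.
move=> H Hh; have [e1 e2] := xy Hh; have [e1' e2'] := xy' Hh.
rewrite linearDr [act3 H (f y x' - _)]linearDr linearNr /= !fP // e1 e2 e1' e2'.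
rewrite !linearNr !linearNl !linearZr_LR !linearZl_LR /= !scalerDl !scalerDr.
rewrite !scalerN !scaleNr !opprD !opprK.
by split; rewrite [LHS](AC (2*2) ((1*3)*(4*2))).
Qed.

End Equivariant.
End Weights.

(** * Roots of a compact Lie algebra in real form *)

Section CompactLie.
Variables (R : realType) (g0 : vectType R) (br : {bilinear g0 -> g0 -> g0}).
Variable h0 : {vspace g0}.
Hypotheses (lie : is_lie_bracket br) (cpt : compact_semisimple br).
Hypothesis maxab : maximal_abelian br h0.
Local Notation hd := (dualv (cplxv h0)).
Implicit Types (mu nu : hd) (H x y p q : g0).

Definition killing_ip x y : R := - killing br x y.
Local Notation kf := killing_ip.

Lemma killing_ipP : inner_product kf.
Proof.
split=> [a x y z|x y|x /cpt].
- rewrite /killing_ip /killing mulrN -opprD; congr (- _).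
  rewrite mulr_sumr -big_split; apply: eq_bigr => i _ /=.
  by rewrite linearPl linearP.
- by congr (- _); exact: (ltraceC (ad_linear br x) (ad_linear br y)).
- by rewrite oppr_gt0.
Qed.

Let kfP := killing_ipP.

Lemma killing_ip_inv z x y : kf (br z x) y = - kf x (br z y).
Proof. by rewrite /killing_ip killing_inv. Qed.

Lemma br_self x : br x x = 0. Proof. by case: lie => ->. Qed.

Lemma h0_abelian : {in h0 &, forall H H', br H H' = 0}.
Proof. by case: maxab. Qed.

(** Otherwise h_0 + R x would be a larger abelian subalgebra. *)
Lemma mem_h0 x : {in h0, forall H, br H x = 0} -> x \in h0.
Proof.
move=> cx; have [ab maxh] := maxab.
rewrite -(maxh (h0 + <[x]>)%VS) ?addvSl //; first by rewrite memvE addvSr.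
move=> u v /memv_addP[H Hh [_ /vlineP[a ->] ->]].
move=> /memv_addP[H' Hh' [_ /vlineP[c ->] ->]].
rewrite linearDl !linearDr /= !linearZl_LR !linearZr_LR /= br_self ab // cx //.
by rewrite (lie_anti lie x) cx // oppr0 !(scaler0, addr0).
Qed.

Lemma ad_skew : {in h0, forall H x y, kf (br H x) y = - kf x (br H y)}.
Proof. by move=> H _ x y; rewrite killing_ip_inv. Qed.

Lemma br_derivation : {in h0, forall H x y,
  br H (br x y) = br (br H x) y + br x (br H y)}.
Proof. by move=> H _ x y; exact: lie_leibniz. Qed.

(** The vector of h_0 that represents - i mu for the inner product - B_0. *)
Definition dualvec mu : g0 := xget 0 (fun T : g0 => T \in h0 /\
  {in h0, forall H, kf H T = rwt mu H}).

Lemma dualvecP mu :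
  dualvec mu \in h0 /\ {in h0, forall H, kf H (dualvec mu) = rwt mu H}.
Proof.
rewrite /dualvec; case: xgetP => [T _ //|noT]; exfalso.
have [a x y|T Th TP] := riesz kfP (m := rwt mu) (W := h0).
  exact: rwt_linear.
exact: (noT T).
Qed.

Lemma dualvec_h0 mu : dualvec mu \in h0.
Proof. by case: (dualvecP mu). Qed.

Lemma kf_dualvec mu H : H \in h0 -> kf H (dualvec mu) = rwt mu H.
Proof. by case: (dualvecP mu) => _; apply. Qed.

Lemma dualvec_uniq c mu T : T \in h0 ->
  {in h0, forall H, kf H T = c * rwt mu H} -> T = c *: dualvec mu.
Proof.
move=> Th TP; apply/eqP; rewrite -subr_eq0; apply/eqP.
have Dh : T - c *: dualvec mu \in h0 by rewrite rpredB ?rpredZ ?dualvec_h0.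
apply: (inner_eq0 kfP); rewrite (innerBr kfP) (innerZr kfP) TP ?kf_dualvec //.
by rewrite subrr.
Qed.

Lemma dualvecDz mu nu k :
  dualvec (mu + nu *~ k) = dualvec mu + k%:~R *: dualvec nu.
Proof.
symmetry; rewrite -[RHS]scale1r; apply: dualvec_uniq => [|H Hh].
  by rewrite rpredD ?rpredZ ?dualvec_h0.
by rewrite (innerDr kfP) (innerZr kfP) !kf_dualvec // mul1r rwtD rwtMz.
Qed.

Lemma dualvec_neq0 mu : imag mu -> mu != 0 -> dualvec mu != 0.
Proof.
move=> im; apply: contra => /eqP d0; apply/eqP; apply: rwt_inj => //.
  by move=> H Hh; rewrite wt0.
by move=> H Hh; rewrite rwt0 -kf_dualvec // d0 (inner0r kfP).
Qed.

Lemma root_imag mu : is_root br mu -> imag mu.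
Proof. exact: (weight_imag kfP ad_skew). Qed.

(** The bracket of p + i q with its conjugate has weight 0, so it commutes with
    h_0. *)
Lemma wpair_br_h0 (m : g0 -> R) p q : wpair h0 br m p q -> br p q \in h0.
Proof.
move=> pq; have := wpair_rot (wpair_mulB br_derivation pq pq).
rewrite !br_self addr0 (lie_anti lie q) -opprD opprK => w.
have : br p q + br p q \in h0.
  apply: mem_h0 => H Hh; have [-> _] := w H Hh.
  by rewrite scaler0 oppr0.
by rewrite -mulr2n -scaler_nat rpredZeq pnatr_eq0.
Qed.

(** By invariance, H pairs with [p, q] as [H, p] = - m(H) q pairs with q. *)
Lemma wpair_br mu p q : wpair h0 br (rwt mu) p q ->
  br p q = - kf q q *: dualvec mu.
Proof.
move=> pq; apply: dualvec_uniq => [|H Hh]; first exact: wpair_br_h0 pq.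
rewrite (innerC kfP) killing_ip_inv (lie_anti lie p) (innerNr kfP) opprK.
have [-> _] := pq H Hh.
by rewrite (innerNr kfP) (innerZr kfP) mulNr mulrC.
Qed.

(** ** Multiples of a root *)

Section Multiples.
Variables (mu : hd) (p q : g0).
Hypotheses (im : imag mu) (mu0 : mu != 0) (p0 : p != 0).
Hypothesis pq : wpair h0 br (rwt mu) p q.
Hypothesis root1 : forall x y, wpair h0 br (rwt mu) x y ->
  exists a c, x = a *: p - c *: q /\ y = a *: q + c *: p.

(** Let e = X_beta = p + i q and let f be ad of its conjugate, the negative of
    the adjoint of ad e. For v = x + i y of weight n beta, r = - f v has weight
    (n - 1) beta, so by induction it is 0 or, when n = 2, a multiple of e; in
    both cases [e, r] = 0, whence |r|^2 = (v, [e, r]) = 0. Therefore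
    |[e, v]|^2 = |[e, v]|^2 - |f v|^2 is the inner product of v with the
    commutator of ad e and f applied to v, a negative multiple of n |v|^2, and
    v = 0. *)
Lemma wpair_multiple n x y : (1 < n)%N ->
  wpair h0 br (fun H => n%:R * rwt mu H) x y -> x = 0.
Proof.
elim: n x y => // n IH x y n0 xy.
pose r1 := br x p + br y q; pose r2 := br y p - br x q.
have r : wpair h0 br (fun H => n%:R * rwt mu H) r1 r2.
  apply: eq_wpair (wpair_mulB br_derivation xy pq) => H _.
  by rewrite -natr1 mulrDl mul1r addrK.
have [er1 er2] : br p r1 = br q r2 /\ br p r2 = - br q r1.
  have [n1|n1] := ltnP 1 n.
    have r10 : r1 = 0 by exact: IH r.
    have r20 : r2 = 0.
      by apply/eqP; rewrite -oppr_eq0; apply/eqP/(IH _ r1 n1)/wpair_rot.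
    by rewrite r10 r20 !linear0r oppr0.
  have n1' : n = 1%N by apply/eqP; rewrite eqn_leq n1.
  have [|a [c [-> ->]]] := root1 (x := r1) (y := r2).
    by apply: eq_wpair r => H _; rewrite n1' mul1r.
  rewrite !linearDr !linearNr !linearZr_LR /= !br_self !scaler0.
  by rewrite (lie_anti lie q p) !scalerN !(add0r, addr0, sub0r, subr0, opprK).
have [r10 r20] : r1 = 0 /\ r2 = 0.
  apply: (inner_add_eq0 kfP).
  have -> : kf r1 r1 = kf (br p r1) x + kf (br q r1) y.
    rewrite {2}/r1 (lie_anti lie x) (lie_anti lie y) (innerDr kfP) !(innerNr kfP).
    by rewrite -!killing_ip_inv.
  have -> : kf r2 r2 = kf (br p r2) y - kf (br q r2) x.
    rewrite {2}/r2 (lie_anti lie x) (lie_anti lie y) opprK (innerDr kfP).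
    by rewrite (innerNr kfP) -killing_ip_inv [kf (br q r2) x]killing_ip_inv opprK.
  by rewrite er1 er2 (innerNl kfP); lra.
have q0 : q != 0.
  by apply: contra p0 => /eqP/(wpair_rwt_eq0 im mu0 pq)/eqP.
pose D := dualvec mu; have Dh : D \in h0 := dualvec_h0 mu.
have D0 : 0 < kf D D by rewrite (inner_gt0 kfP) ?dualvec_neq0.
have q2 : 0 < kf q q by rewrite (inner_gt0 kfP).
have e1 : kf (br p x) (br p x) = - kf (br p x) (br q y).
  move/eqP: r10; rewrite /r1 (lie_anti lie x) (lie_anti lie y) -opprD oppr_eq0.
  by rewrite addr_eq0 => /eqP e; rewrite {2}e (innerNr kfP).
have e2 : kf (br p y) (br p y) = kf (br p y) (br q x).
  move/eqP: r20; rewrite /r2 (lie_anti lie x) (lie_anti lie y) opprK addrC.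
  by rewrite subr_eq0 => /eqP e; rewrite e.
have e3 : kf (br p x) (br p x) + kf (br p y) (br p y) =
    - (kf q q * (n.+1%:R * kf D D) * kf x x).
  rewrite e1 e2 killing_ip_inv opprK (innerC kfP (br p y)) killing_ip_inv.
  rewrite -(innerBr kfP).
  have -> : br p (br q y) - br q (br p y) = br (br p q) y.
    by rewrite [br p (br q y)](lie_leibniz lie) addrK.
  rewrite (wpair_br pq) linearZl_LR /= (innerZr kfP).
  have [_ ->] := xy D Dh; rewrite (innerZr kfP) -(kf_dualvec _ Dh) -/D.
  by ring.
apply/eqP; apply: contraT => x0; have x2 := inner_gt0 kfP x0.
have := inner_ge0 kfP (br p x); have := inner_ge0 kfP (br p y).
have : 0 < kf q q * (n.+1%:R * kf D D) * kf x x.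
  by rewrite !mulr_gt0 // ltr0n.
by lra.
Qed.

Lemma wpair_multiple_int (k : int) x y : k != 0 -> k != 1 -> k != -1 ->
  wpair h0 br (fun H => k%:~R * rwt mu H) x y -> x = 0.
Proof.
case: k => n k0 k1 k2 xy.
  by apply: (@wpair_multiple n x y) xy; case: n k0 k1 k2 => [|[]].
apply: (@wpair_multiple n.+1 x (- y)); first by case: n k2 k0 k1 xy.
apply: eq_wpair (wpair_conj xy) => H _.
by rewrite NegzE mulrNz mulNr opprK.
Qed.

End Multiples.
End CompactLie.

(** * The compact Chevalley basis *)

Section WeightDecomposition.
Variables (R : rcfType) (g0 : vectType R) (h0 : {vspace g0}).
Variables (M : vectType R) (act : {bilinear g0 -> M -> M}).
Local Notation hd := (dualv (cplxv h0)).
Local Notation "''V_' mu" := (weight_space (cbil act) (mu : hd))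
  (at level 8, mu at level 2).

Lemma weight_space_disjoint (mu nu : hd) z :
  z != 0 -> z \in 'V_mu -> z \in 'V_nu -> mu = nu.
Proof.
move=> z0 /weight_spaceP zm /weight_spaceP zn; apply: wt_inj => H Hh.
have := zm H Hh; rewrite zn // => /eqP; rewrite -subr_eq0 -scalerBl scaler_eq0.
by rewrite (negPf z0) orbF subr_eq0 => /eqP.
Qed.

(** Apply H - mu(H) to the expansion of z in e: the coefficient of a basis vector
    of weight nu is multiplied by nu(H) - mu(H), so it is 0 unless nu = mu. *)
Lemma weight_space_span (e : seq (cplx M)) (mu : hd) z :
  basis_of {:cplx M} e -> (forall v, v \in e -> exists nu, v \in 'V_nu) ->
  z \in 'V_mu -> z \in <<[seq v <- e | v \in 'V_mu]>>%VS.
Proof.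
move=> eb ew zm; have fe := basis_free eb.
have zE := coord_basis (eb : basis_of _ (in_tuple e)) (memvf z).
have eN i : (i < size e)%N -> e`_i \in e by exact: mem_nth.
have ewi (i : 'I_(size e)) : exists nu : hd, e`_i \in 'V_nu by exact/ew/eN.
have [nu nuP] := choice ewi.
rewrite zE; apply: memv_suml => i _.
have [ei|ei] := boolP (e`_i \in 'V_mu).
  by apply/memvZ/memv_span; rewrite mem_filter ei eN.
suff -> : coord (in_tuple e) i z = 0 by rewrite scale0r mem0v.
apply/eqP; apply: contraR ei => ci; suff <- : nu i = mu by [].
apply: wt_inj => H Hh; move/weight_spaceP: zm => /(_ H Hh)/eqP.
rewrite -subr_eq0 => /eqP zH.
have /freeP/(_ (fun j => coord (in_tuple e) j z * (wt (nu j) H - wt mu H))) :=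
  (fe : free (in_tuple e)).
move=> /(_ _ i)/eqP; rewrite mulf_eq0 (negPf ci) subr_eq0 => e0; apply/eqP/e0.
rewrite -[RHS]zH [X in _ = cbil _ _ X - _]zE [X in _ = _ - _ *: X]zE.
rewrite scaler_sumr.
have lin : linear (cbil act (cemb H)).
  move=> a u v; rewrite !cbil_cemb !cplx_scaleE /=.
  by congr pair; rewrite /= !linearDr ?linearNr !linearZr_LR.
rewrite (linear_combP lin) -sumrB; apply: eq_bigr => j _.
have /weight_spaceP/(_ H Hh) -> := nuP j.
by rewrite !scalerA -scalerBl mulrBr [wt mu H * _]mulrC.
Qed.

End WeightDecomposition.

Section Chevalley.
Variables (R : realType) (g0 : vectType R) (br : {bilinear g0 -> g0 -> g0}).
Variables (h0 : {vspace g0}) (Delta : seq (hdual h0)) (X : hdual h0 -> cplx g0).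
Hypotheses (lie : is_lie_bracket br) (cpt : compact_semisimple br).
Hypothesis maxab : maximal_abelian br h0.
Hypotheses (base : is_root_base br Delta) (chev : chevalley_basis br Delta X).
Local Notation kf := (killing_ip br).
Local Notation dualvec := (@dualvec R g0 br h0).
Let kfP := killing_ipP cpt.

(** On h the Killing form is the complex bilinear extension of a definite form, so
    H_alpha is unique; it is - i times the real dual vector of - i alpha. *)
Lemma Hroot_dualvec (alpha : hdual h0) :
  imag alpha -> Hroot br alpha = (0, - dualvec alpha).
Proof.
move=> im; have [Dh DP] := dualvecP cpt alpha.
have cand (z : subvs_of (cplxv h0)) :
    killing (cbil br) (vsval z) (0, - dualvec alpha) = alpha z.
  have := subvsP z; rewrite mem_cplxv => /andP[z1 z2].
  rewrite killing_cplx wt_split !(wt_imag im) //.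
  have kN x y : killing br x y = - kf x y by rewrite /killing_ip opprK.
  rewrite !kN !(innerNr kfP) !(inner0r kfP) !DP //.
  by apply/eqP; rewrite eq_complex /=; apply/andP; split; apply/eqP; ring.
rewrite /Hroot; case: xgetP => [H _ [Hh HP]|/(_ (0, - dualvec alpha))]; last first.
  by case; split=> //; rewrite mem_cplxv mem0v rpredN.
have Kh : H - (0, - dualvec alpha) \in cplxv h0.
  by rewrite rpredB // mem_cplxv mem0v rpredN.
apply/eqP; rewrite -subr_eq0; set K := H - _ in Kh *.
have K0 (z : subvs_of (cplxv h0)) : killing (cbil br) (vsval z) K = 0.
  have : killing (cbil br) (vsval z) K =
    killing (cbil br) (vsval z) H -
    killing (cbil br) (vsval z) (0, - dualvec alpha).
    rewrite !killing_cplx /K; case: (H) => a c /=.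
    have kN x y : killing br x y = - kf x y by rewrite /killing_ip opprK.
    rewrite !kN !(innerBr kfP); apply/eqP; rewrite eq_complex /=.
    by apply/andP; split; apply/eqP; ring.
  by rewrite HP cand subrr.
move: Kh K0; rewrite mem_cplxv {HP Hh}; move: K => K /andP[K1 K2] K0.
have /eqP := K0 (vsproj _ (cemb K.1)); rewrite vsprojK ?cemb_h //.
have /eqP := K0 (vsproj _ (cemb K.2)); rewrite vsprojK ?cemb_h //.
rewrite !killing_cplx !eq_complex /=.
have kN x y : killing br x y = - kf x y by rewrite /killing_ip opprK.
rewrite !kN !(inner0l kfP) oppr0 !subr0 !addr0 !oppr_eq0.
have kE x : killing br x x = 0 -> x = 0.
  by move=> x0; apply: (inner_eq0 kfP); rewrite /killing_ip x0 oppr0.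
move=> /andP[_ /eqP/kE K20] /andP[/eqP/kE K10 _].
by rewrite [K]surjective_pairing K10 K20.
Qed.

Lemma tau_dualvec (alpha : hdual h0) : imag alpha -> tau br alpha =
  (0, - (2 / kf (dualvec alpha) (dualvec alpha) *: dualvec alpha)).
Proof.
move=> im; rewrite /tau Hroot_dualvec // killing_cplx /=; set D := dualvec alpha.
have kN x y : killing br x y = - kf x y by rewrite /killing_ip opprK.
rewrite !kN !(inner0l kfP) !(inner0r kfP) (innerNr kfP) (innerNl kfP).
rewrite oppr0 addr0 sub0r !opprK.
set c := kf D D.
have -> : (2 / (c +i* 0)%C : R[i]) = ((2 / c)%:C)%C.
  by rewrite rmorphM /= fmorphV rmorph_nat.
by rewrite cplx_scaleE /= !scaler0 scale0r subr0 addr0 scalerN.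
Qed.

Lemma cemb_ttau (alpha : hdual h0) :
  imag alpha -> cemb (ttau br alpha) = 'i%C *: tau br alpha.
Proof.
move=> im; pose D := dualvec alpha.
rewrite /ttau; case: xgetP => [//|/(_ (2 / kf D D *: D))].
case; rewrite /= tau_dualvec // cplx_scaleE /= !scale0r scale1r opprK add0r.
by rewrite scaler0 add0r.
Qed.

Lemma ttau_dualvec (alpha : hdual h0) : imag alpha ->
  ttau br alpha = 2 / kf (dualvec alpha) (dualvec alpha) *: dualvec alpha.
Proof.
move=> im; have := cemb_ttau im; rewrite tau_dualvec // cplx_scaleE /=.
by rewrite scale0r scale1r opprK add0r => -[].
Qed.

Lemma ttau_h0 (alpha : hdual h0) : imag alpha -> ttau br alpha \in h0.
Proof. by move=> im; rewrite ttau_dualvec // rpredZ ?(dualvec_h0 cpt). Qed.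

Lemma chevalley_seq : exists e : seq (cplx g0),
  [/\ basis_of {:cplx g0} e,
      forall beta, is_root br beta -> X beta \in e
    & forall v, v \in e -> (exists2 beta, is_root br beta & v = X beta) \/
                          (exists2 alpha, alpha \in Delta & v = tau br alpha)].
Proof.
have [_ [e eP eb] _ _ _] := chev; exists e; split=> // [beta rb|v /eP//].
by apply/eP; left; exists beta.
Qed.

Lemma X_root_space (beta : hdual h0) : is_root br beta ->
  X beta \in weight_space (cbil br) beta.
Proof. by have [+ _ _ _ _] := chev; apply. Qed.

Lemma X_neq0 (beta : hdual h0) : is_root br beta -> X beta != 0.
Proof.
have [e [eb eX _]] := chevalley_seq => /eX eXb.
exact: free_not0 (basis_free eb) eXb.
Qed.

Lemma simple_root (alpha : hdual h0) : alpha \in Delta -> is_root br alpha.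
Proof. by have [/allP + _ _] := base; apply. Qed.

Lemma simple_imag (alpha : hdual h0) : alpha \in Delta -> imag alpha.
Proof. by move/simple_root/(root_imag lie cpt). Qed.

Lemma root_neq0 (beta : hdual h0) : is_root br beta -> beta != 0.
Proof. by case/andP. Qed.

Lemma tau_weight0 (alpha : hdual h0) : imag alpha ->
  tau br alpha \in weight_space (cbil br) (0 : hdual h0).
Proof.
move=> im; apply/weight_spaceP => H Hh; rewrite wt0 scale0r cbil_cemb.
rewrite tau_dualvec //= linear0r linearNr linearZr_LR /=.
by rewrite (h0_abelian maxab) ?(dualvec_h0 cpt) // scaler0 oppr0.
Qed.

Lemma chevalley_weights (e : seq (cplx g0)) :
  (forall v, v \in e -> (exists2 beta, is_root br beta & v = X beta) \/
                       (exists2 alpha, alpha \in Delta & v = tau br alpha)) ->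
  forall v, v \in e -> exists nu : hdual h0, v \in weight_space (cbil br) nu.
Proof.
move=> eS v /eS[[beta rb ->]|[alpha aD ->]].
  by exists beta; exact: X_root_space.
by exists 0; apply/tau_weight0/simple_imag.
Qed.

(** X_beta is the only vector of weight beta in the basis of g. *)
Lemma root_space_line (beta : hdual h0) z : is_root br beta ->
  z \in weight_space (cbil br) beta -> exists c, z = c *: X beta.
Proof.
move=> rb zb; have [e [eb eX eS]] := chevalley_seq.
have := weight_space_span eb (chevalley_weights eS) zb.
suff /subvP/(_ z) sub : (<<[seq v <- e | v \in weight_space (cbil br) beta]>>
    <= <[X beta]>)%VS by move=> /sub/vlineP.
apply/span_subvP => v; rewrite mem_filter => /andP[vb /[dup] ve /eS vS].
have v0 : v != 0 by exact: free_not0 (basis_free eb) ve.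
case: vS => [[gamma rg ev]|[alpha aD ev]].
  have -> : v = X beta; last exact: memv_line.
  rewrite ev; congr X; apply: weight_space_disjoint v0 _ vb.
  by rewrite ev X_root_space.
case/eqP: (root_neq0 rb); apply: weight_space_disjoint v0 vb _.
by rewrite ev; exact/tau_weight0/simple_imag.
Qed.

(** The basis vectors of weight 0 are the tau_alpha, alpha simple; take real
    parts. *)
Lemma h0_span H : H \in h0 -> H \in <<[seq ttau br alpha | alpha <- Delta]>>%VS.
Proof.
move=> Hh; have [e [eb eX eS]] := chevalley_seq; set W := <<_>>%VS.
have H0 : cemb H \in weight_space (cbil br) (0 : hdual h0).
  apply/weight_spaceP => H' Hh'; rewrite cbil_cemb wt0 scale0r linear0r.
  by rewrite (h0_abelian maxab).
have := weight_space_span eb (chevalley_weights eS) H0.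
suff /subvP/(_ (cemb H)) sub :
    (<<[seq v <- e | v \in weight_space (cbil br) (0%R : hdual h0)]>>
    <= cplxv W)%VS by move=> /sub; rewrite mem_cplxv => /andP[].
apply/span_subvP => v; rewrite mem_filter => /andP[v0 /[dup] ve /eS vS].
have vn0 : v != 0 by exact: free_not0 (basis_free eb) ve.
case: vS => [[gamma rg ev]|[alpha aD ->]].
  case/eqP: (root_neq0 rg); apply: weight_space_disjoint vn0 _ v0.
  by rewrite ev X_root_space.
have im := simple_imag aD.
rewrite tau_dualvec // mem_cplxv mem0v -ttau_dualvec //=.
by rewrite rpredN memv_span //; apply: map_f.
Qed.

Lemma ttau_compact (alpha : hdual h0) : alpha \in Delta ->
  compact_basis br Delta X (ttau br alpha).
Proof.
by move=> aD; left; exists alpha; rewrite // cemb_ttau //; exact: simple_imag.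
Qed.

(** Reality of X_beta - X_-beta and i X_beta + i X_-beta says that X_-beta
    is minus the complex conjugate of X_beta. *)
Lemma root_vector (beta : hdual h0) : positive_root br Delta beta -> exists p q : g0,
  [/\ X beta = (p, q), wpair h0 br (rwt beta) p q, p != 0,
      ttau br beta = - 2 *: br p q
    & compact_basis br Delta X (2 *: p) /\
      compact_basis br Delta X (- 2 *: q)].
Proof.
move=> pb; have rb := pb.1; have im := root_imag lie cpt rb.
have [_ _ Xtau _ [real _]] := chev.
have cx : compact_basisC br Delta X (X beta - X (- beta)).
  by right; exists beta => //; left.
have cy : compact_basisC br Delta X ('i%C *: X beta + 'i%C *: X (- beta)).
  by right; exists beta => //; right.
have [x ex] := real _ cx; have [y ey] := real _ cy.
case eX : (X beta) (X_root_space rb) (X_neq0 rb) => [p q] Xb Xn0.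
case eX' : (X (- beta)) => [p' q'].
have [ex1 ex2] : p - p' = x /\ q - q' = 0.
  by move: ex; rewrite eX eX' => -[].
have [ey1 ey2] : - q - q' = y /\ p + p' = 0.
  move: ey; rewrite eX eX' !cplx_scaleE /= => -[].
  by rewrite !scale0r !scale1r !sub0r !add0r.
have qq : q' = q by apply/eqP; rewrite eq_sym -subr_eq0 ex2.
have pp : p' = - p by apply/eqP; rewrite -addr_eq0 addrC ey2.
subst q' p'.
have pq : wpair h0 br (rwt beta) p q by apply/(weight_space_wpair br).
exists p, q; split=> //.
- apply: contra Xn0 => /eqP p0.
  have [/(_ p0) q0 _] := wpair_rwt_eq0 im (root_neq0 rb) pq.
  by rewrite p0 q0.
- have := Xtau _ rb; rewrite eX eX' /cbil /= tau_dualvec // -ttau_dualvec //.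
  move=> [_]; rewrite linearNr /= (lie_anti lie q) opprK => e.
  by apply: oppr_inj; rewrite -e scaleNr opprK scaler_nat mulr2n.
- split; rewrite /compact_basis /=.
    by move: cx; rewrite ex -ex1 opprK -mulr2n scaler_nat.
  by move: cy; rewrite ey -ey1 -opprD -mulr2n scaleNr scaler_nat.
Qed.

Lemma wpair_root_line (beta : hdual h0) p q x y : positive_root br Delta beta ->
  X beta = (p, q) -> wpair h0 br (rwt beta) x y ->
  exists a c, x = a *: p - c *: q /\ y = a *: q + c *: p.
Proof.
move=> [rb _] eX /(weight_space_wpair br _ _ (root_imag lie cpt rb)).
move=> /(root_space_line rb)[[a c]]; rewrite eX cplx_scaleE => -[-> ->].
by exists a, c.
Qed.

End Chevalley.

(** * Quaternions *)

Section Quaternions.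
Variables (R : fieldType) (L : vectType R).

Definition quat_coord (e : 4.-tuple L) (x : L) : quaternion R :=
  (coord e 0 x : R^o, coord e 1 x : R^o, coord e 2 x : R^o, coord e 3 x : R^o).

Fact quat_coord_linear e : linear (quat_coord e).
Proof. by move=> a x y; rewrite /quat_coord !linearP. Qed.

HB.instance Definition _ e := GRing.isLinear.Build R L (quaternion R) _
  (quat_coord e) (quat_coord_linear e).

Variables (br : {bilinear L -> L -> L}) (e0 e1 e2 e3 : L).
Hypotheses (lie : is_lie_bracket br) (fe : free [:: e0; e1; e2; e3]).
(** The commutators of 1, i, j, k. *)
Hypotheses (br01 : br e0 e1 = 0) (br02 : br e0 e2 = 0) (br03 : br e0 e3 = 0).
Hypotheses (br12 : br e1 e2 = 2 *: e3) (br23 : br e2 e3 = 2 *: e1).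
Hypothesis br31 : br e3 e1 = 2 *: e2.
Let W := <<[:: e0; e1; e2; e3]>>%VS.

Let comb (a0 a1 a2 a3 : R) := a0 *: e0 + a1 *: e1 + a2 *: e2 + a3 *: e3.

Let combP x : x \in W -> exists a0 a1 a2 a3, x = comb a0 a1 a2 a3.
Proof.
move=> /(coord_span (X := in_tuple [:: e0; e1; e2; e3])) ->.
by rewrite !big_ord_recr big_ord0 /= add0r; do 4!eexists.
Qed.

Let comb_mem a0 a1 a2 a3 : comb a0 a1 a2 a3 \in W.
Proof. by rewrite !rpredD ?rpredZ ?memv_span ?inE ?eqxx ?orbT. Qed.

Let br_comb a0 a1 a2 a3 c0 c1 c2 c3 :
  br (comb a0 a1 a2 a3) (comb c0 c1 c2 c3) =
  comb 0 (2 * (a2 * c3 - a3 * c2)) (2 * (a3 * c1 - a1 * c3))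
         (2 * (a1 * c2 - a2 * c1)).
Proof.
have [brxx _] := lie.
rewrite /comb !linearDl !linearDr !linearZl_LR !linearZr_LR /= !brxx.
rewrite (lie_anti lie e1 e0) (lie_anti lie e2 e0) (lie_anti lie e3 e0).
rewrite (lie_anti lie e2 e1) (lie_anti lie e3 e2) (lie_anti lie e1 e3).
rewrite br01 br02 br03 br12 br23 br31 oppr0 !scaler0 !(add0r, addr0) scale0r add0r.
rewrite -!scaleNr !scalerA [LHS](AC (2*2*2) ((4*6)*(2*5)*(1*3))) /= -!scalerDl.
by congr (_ *: _ + _ *: _ + _ *: _); ring.
Qed.

Let e := [tuple e0; e1; e2; e3].

Let coord_comb a0 a1 a2 a3 i :
  coord e i (comb a0 a1 a2 a3) = [:: a0; a1; a2; a3]`_i.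
Proof.
have -> : comb a0 a1 a2 a3 = \sum_(j < 4) [:: a0; a1; a2; a3]`_j *: e`_j.
  by rewrite !big_ord_recr big_ord0 /= add0r.
by rewrite coord_sum_free.
Qed.

Let quat_comb a0 a1 a2 a3 : quat_coord e (comb a0 a1 a2 a3) = (a0, a1, a2, a3).
Proof. by rewrite /quat_coord !coord_comb. Qed.

Lemma quaternion_subalgebra : subalgebra br W.
Proof.
move=> x y /combP[a0 [a1 [a2 [a3 ->]]]] /combP[c0 [c1 [c2 [c3 ->]]]].
by rewrite br_comb comb_mem.
Qed.

Lemma quaternion_isomorphism : isomorphic_to_quaternions br W.
Proof.
exists (linfun (quat_coord e)); split.
- move=> x y /combP[a0 [a1 [a2 [a3 ->]]]] /combP[c0 [c1 [c2 [c3 ->]]]].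
  by rewrite !lfunE /= !quat_comb => -[-> -> -> ->].
- apply/vspaceP => -[[[a0 a1] a2] a3]; rewrite memvf; apply/memv_imgP.
  by exists (comb a0 a1 a2 a3); rewrite ?comb_mem // lfunE /= quat_comb.
move=> x y /combP[a0 [a1 [a2 [a3 ->]]]] /combP[c0 [c1 [c2 [c3 ->]]]].
rewrite br_comb !lfunE /= !quat_comb.
by congr (_, _, _, _); rewrite /= !coord_comb /=; ring.
Qed.

End Quaternions.

(** * The metric Lie algebra U + g_0 *)

Definition nil_bracket (R : fieldType) (g0 U : vectType R)
    (nbr : {bilinear (U * g0)%type -> (U * g0)%type -> (U * g0)%type})
    (u v : U) : g0 := (nbr (u, 0) (v, 0)).2.

Fact nil_bracket_bilinear (R : fieldType) (g0 U : vectType R) nbr :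
  bilinear_for *:%R *:%R (@nil_bracket R g0 U nbr).
Proof.
have pl a (u v : U) : (a *: u + v, 0 : g0) = a *: (u, 0) + (v, 0).
  by congr pair; rewrite /= scaler0 addr0.
split=> [v a u u'|u a v v']; rewrite /nil_bracket pl.
  by rewrite linearPl.
by rewrite linearPr.
Qed.

HB.instance Definition _ (R : fieldType) (g0 U : vectType R) nbr :=
  bilinear_isBilinear.Build R U U g0 *:%R *:%R (@nil_bracket R g0 U nbr)
    (nil_bracket_bilinear nbr).

Section MetricLie.
Variables (R : realType) (g0 U : vectType R).
Variables (br : {bilinear g0 -> g0 -> g0}) (act : {bilinear g0 -> U -> U}).
Variables (ip : {dot (U * g0)%type for @idfun R}).
Variable nbr : {bilinear (U * g0)%type -> (U * g0)%type -> (U * g0)%type}.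
Hypotheses (lie : is_lie_bracket br) (cpt : compact_semisimple br).
Hypothesis actP : is_lie_action br act.
Hypothesis ipUg : forall u Z, ip (u, 0) (0, Z) = 0.
Hypothesis ip_skew : forall Z u v, ip (act Z u, 0) (v, 0) = - ip (u, 0) (act Z v, 0).
Hypothesis ip_killing : forall Z Z', ip (0, Z) (0, Z') = - killing br Z Z'.
Hypothesis nbrP : is_n0_bracket act ip nbr.
Local Notation kf := (killing_ip br).
Local Notation nb := (nil_bracket nbr).
Let kfP := killing_ipP cpt.

Definition mod_ip (u v : U) : R := ip (u, 0) (v, 0).
Local Notation uf := mod_ip.

Lemma ipC x y : ip x y = ip y x.
Proof. by rewrite hermC expr0 mul1r. Qed.

Lemma mod_ipP : inner_product uf.
Proof.
split=> [a x y z|x y|x x0].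
- rewrite /uf -linearPl; congr (ip _ _); congr pair.
  by rewrite /= scaler0 addr0.
- exact: ipC.
- by apply: neq0_dnorm_gt0; apply: contra x0 => /eqP[->].
Qed.
Let ufP := mod_ipP.

Lemma uf_skew Z u v : uf (act Z u) v = - uf u (act Z v).
Proof. exact: ip_skew. Qed.

Lemma ip_pair u Z v Z' : ip (u, Z) (v, Z') = uf u v + kf Z Z'.
Proof.
have pE (w : U) (Y : g0) : (w, Y) = (w, 0) + (0, Y).
  by congr pair; rewrite /= ?addr0 ?add0r.
rewrite (pE u) (pE v) linearDl !linearDr /= ipUg ip_killing addr0.
by rewrite (ipC (0, Z)) ipUg add0r.
Qed.

Lemma nbrE x y : nbr x y = (0, nb x.1 y.1).
Proof.
have [nbrg nbrU _] := nbrP.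
have pE (z : U * g0) : z = (z.1, 0) + (0, z.2).
  by rewrite [LHS]surjective_pairing; congr pair; rewrite /= ?addr0 ?add0r.
rewrite [LHS]surjective_pairing nbrU; congr pair.
rewrite {1}[x]pE {1}[y]pE linearDl !linearDr /=.
by rewrite (nbrg x.2 (y.1, 0)).1 (nbrg x.2 _).1 (nbrg y.2 _).2 !addr0.
Qed.

Lemma kf_nb u v Z : kf (nb u v) Z = uf (act Z u) v.
Proof.
have [_ nbrU nbr3] := nbrP.
rewrite -[RHS]nbr3 nbrE /= ip_pair /= (inner0l ufP) add0r //.
Qed.

Lemma kf_eq x y : (forall Z, kf x Z = kf y Z) -> x = y.
Proof.
move=> xy; apply/eqP; rewrite -subr_eq0; apply/eqP/(inner_eq0 kfP).
by rewrite (innerBl kfP) xy subrr.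
Qed.

(** Pair both sides with Y in g_0: invariance of the inner products on g_0 and on
    U turns the claim into the module identity for [Y, Z]. *)
Lemma nb_derivation Z u v : br Z (nb u v) = nb (act Z u) v + nb u (act Z v).
Proof.
apply: kf_eq => Y; rewrite (innerDl kfP) (killing_ip_inv lie) !kf_nb actP.
rewrite (innerBl ufP) opprB; congr (_ + _).
by rewrite (uf_skew Z) opprK.
Qed.

Lemma act_derivation Z x u : act Z (act x u) = act (br Z x) u + act x (act Z u).
Proof. by rewrite actP subrK. Qed.

(** The Koszul formula for a 2-step nilpotent bracket with values in the central
    subspace g_0. *)
Definition nil_nabla (x y : U * g0) : U * g0 :=
  (- 2^-1 *: (act x.2 y.1 + act y.2 x.1), 2^-1 *: nb x.1 y.1).

Fact nil_nabla_bilinear : bilinear_for *:%R *:%R nil_nabla.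
Proof.
split=> [y a x x'|x a y y']; rewrite /nil_nabla /=; congr pair; rewrite /=.
- by rewrite linearPl linearPr /= addrACA -scalerDr [LHS]scalerDr !scalerA mulrC.
- by rewrite linearPl /= scalerDr !scalerA mulrC.
- by rewrite linearPl linearPr /= addrACA -scalerDr [LHS]scalerDr !scalerA mulrC.
- by rewrite linearPr /= scalerDr !scalerA mulrC.
Qed.

HB.instance Definition _ := bilinear_isBilinear.Build R _ _ _ *:%R *:%R
  nil_nabla nil_nabla_bilinear.

Lemma nb_anti u v : nb v u = - nb u v.
Proof.
apply: kf_eq => Z; rewrite (innerNl kfP) !kf_nb uf_skew.
by rewrite (innerC ufP).
Qed.

Lemma nil_nabla_levi_civita : is_levi_civita ip nbr nil_nabla.
Proof.
split=> [x y|[u Z] [v Z'] [w Z'']].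
  rewrite /nil_nabla nbrE; congr pair; rewrite /=.
    by rewrite addrC [act y.2 _ + _]addrC addNr.
  rewrite (nb_anti x.1) scalerN opprK -scalerDl.
  have -> : 2^-1 + 2^-1 = 1 :> R by field.
  by rewrite scale1r.
rewrite /nil_nabla /= !ip_pair (innerZl ufP) (innerZr ufP).
rewrite (innerDl ufP) (innerDr ufP).
rewrite (innerZl kfP) (innerZr kfP) (innerC kfP Z') !kf_nb (uf_skew Z v w).
by rewrite (innerC ufP v (act Z'' u)); ring.
Qed.

End MetricLie.

(** * The string of lambda through beta *)

Section String.
Variables (R : realType) (g0 U : vectType R).
Variables (br : {bilinear g0 -> g0 -> g0}) (act : {bilinear g0 -> U -> U}).
Variable h0 : {vspace g0}.
Variables (ip : {dot (U * g0)%type for @idfun R}).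
Variable nbr : {bilinear (U * g0)%type -> (U * g0)%type -> (U * g0)%type}.
Hypotheses (lie : is_lie_bracket br) (cpt : compact_semisimple br).
Hypothesis actP : is_lie_action br act.
Hypothesis maxab : maximal_abelian br h0.
Hypothesis ipUg : forall u Z, ip (u, 0) (0, Z) = 0.
Hypothesis ip_skew : forall Z u v, ip (act Z u, 0) (v, 0) = - ip (u, 0) (act Z v, 0).
Hypothesis ip_killing : forall Z Z', ip (0, Z) (0, Z') = - killing br Z Z'.
Hypothesis nbrP : is_n0_bracket act ip nbr.
Local Notation kf := (killing_ip br).
Local Notation uf := (mod_ip ip).
Local Notation nb := (nil_bracket nbr).
Let kfP := killing_ipP cpt.
Let ufP := mod_ipP ip.

Variables lambda beta : hdual h0.
Hypotheses (il : imag lambda) (ib : imag beta).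
Hypothesis lb_free : free [:: lambda; beta].
Local Notation U' := (U_string act lambda beta).
Local Notation L := (dualvec br lambda).
Local Notation D := (dualvec br beta).

Lemma lin_indep (a c : R[i]) : a *: lambda + c *: beta = 0 -> a = 0.
Proof.
move: lb_free; rewrite free_cons span_seq1 => /andP[ln _] e.
apply/eqP; apply: contraR ln => a0; apply/vlineP; exists (- (a^-1 * c)).
move/eqP: e; rewrite addr_eq0 => /eqP e.
by rewrite scaleNr -scalerA -scalerN -e scalerA mulVf // scale1r.
Qed.

Lemma beta_neq0 : beta != 0.
Proof.
by move: lb_free; rewrite !free_cons span_nil memv0 => /and3P[].
Qed.

Lemma string_neq0 k : lambda + beta *~ k != 0.
Proof.
apply/eqP => e; have := @lin_indep 1 k%:~R; rewrite scale1r scaler_int => /(_ e).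
by move/eqP; rewrite oner_eq0.
Qed.

Lemma string2_neq0 k : lambda *+ 2 + beta *~ k != 0.
Proof.
apply/eqP => e; have := @lin_indep 2 k%:~R; rewrite scaler_nat scaler_int.
by move=> /(_ e)/eqP; rewrite pnatr_eq0.
Qed.

Lemma string_imag k : imag (lambda + beta *~ k).
Proof. by apply: imagD => //; apply: imagMz. Qed.

Lemma U_weight_wpair (mu : hdual h0) u : imag mu -> mu != 0 ->
  u \in U_weight act mu <-> exists y, wpair h0 act (rwt mu) u y.
Proof.
move=> im mu0; rewrite /U_weight (negPf mu0); case: ifPn => wt.
  exact: real_points_wpair.
rewrite memv0; split=> [/eqP->|[y uy]]; first by exists 0; exact: wpair0.
by apply/eqP; exact: wpair_not_weight uy.
Qed.

Lemma U_string_gen k u y :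
  wpair h0 act (rwt (lambda + beta *~ k)) u y -> u \in U'.
Proof.
move=> uy; apply: mem_vspan; exists k.
by apply/U_weight_wpair; [exact: string_imag|exact: string_neq0|exists y].
Qed.

Lemma U_string_ind (P : U -> Prop) : P 0 ->
  (forall a u v, P u -> P v -> P (a *: u + v)) ->
  (forall k u y, wpair h0 act (rwt (lambda + beta *~ k)) u y -> P u) ->
  {in U', forall u, P u}.
Proof.
move=> P0 PP Pgen u uU.
have /subvP/(_ u uU) : (U' <= vspan (fun v => P v))%VS.
  apply: vspan_le => v [k /U_weight_wpair].
  case; [exact: string_imag|exact: string_neq0|].
  by move=> y /Pgen Pv; apply: mem_vspan.
by rewrite mem_vspan_submod // => /asboolP.
Qed.

Let act_der : {in h0, forall H x u,
  act H (act x u) = act (br H x) u + act x (act H u)}.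
Proof. by move=> H _ x u; apply: act_derivation. Qed.

Let nb_der : {in h0, forall H u v, br H (nb u v) = nb (act H u) v + nb u (act H v)}.
Proof.
move=> H _ u v.
exact: (nb_derivation lie cpt actP ipUg ip_skew ip_killing nbrP).
Qed.

(** A real root vector is the sum of a vector of weight beta and one of weight
    - beta, which move the string one step up and one step down. *)
Lemma act_root_string x y u :
  wpair h0 br (rwt beta) x y -> u \in U' -> act x u \in U'.
Proof.
move=> xy; move: u; apply: U_string_ind => [|a u v au av|k u w uw].
- by rewrite linear0r mem0v.
- by rewrite linearPr /= rpredD ?rpredZ.
rewrite (half_sum (act x u) (act y w)); apply/rpredZ/rpredD.
  apply: (U_string_gen (k := k + 1)).
  apply: eq_wpair (wpair_mulD act_der xy uw) => H _.
  by rewrite !rwtD !rwtMz intrD; ring.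
apply: (U_string_gen (k := k - 1)).
apply: eq_wpair (wpair_conj (wpair_mulB act_der xy uw)) => H _.
by rewrite !rwtD !rwtMz intrB; ring.
Qed.

Lemma act_h0_string H u : H \in h0 -> u \in U' -> act H u \in U'.
Proof.
move=> Hh; move: u; apply: U_string_ind => [|a u v au av|k u w uw].
- by rewrite linear0r mem0v.
- by rewrite linearPr /= rpredD ?rpredZ.
have [-> _] := uw H Hh; rewrite -scalerN rpredZ //.
exact: U_string_gen (wpair_rot uw).
Qed.

Lemma Htilde_dualvec : Htilde ip lambda = L.
Proof.
have [Lh LP] := dualvecP cpt lambda.
have kfE x y : kf x y = ip (0, x) (0, y) by rewrite ip_killing.
rewrite /Htilde; case: xgetP => [Z _ [Zh ZP]|/(_ L)].
  apply/eqP; rewrite -[L]scale1r; apply/eqP/(dualvec_uniq cpt) => // H Hh.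
  rewrite mul1r kfE; have := ZP H Hh; rewrite -/(wt lambda H) wt_imag //.
  by move/(congr1 (@complex.Re R)) => /= ->; ring.
case; split=> // H Hh; rewrite -kfE LP // -/(wt lambda H) wt_imag //.
by apply/eqP; rewrite eq_complex /=; apply/andP; split; apply/eqP; ring.
Qed.

Section Root.
Variables p q : g0.
Hypotheses (p0 : p != 0) (pq : wpair h0 br (rwt beta) p q).
Hypothesis root1 : forall x y, wpair h0 br (rwt beta) x y ->
  exists a c, x = a *: p - c *: q /\ y = a *: q + c *: p.
Hypothesis ttau_pq : ttau br beta = - 2 *: br p q.
Hypothesis ttau_D : ttau br beta = 2 / kf D D *: D.
Local Notation T := (ttau br beta).
Local Notation glb := (g_string br ip lambda beta).

(** The component of H~_lambda orthogonal to H~_beta: as beta vanishes on it, it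
    commutes with g_(0,beta). *)
Definition string_center : g0 := L - kf L D / kf D D *: D.
Local Notation Z := string_center.

Let Lh : L \in h0. Proof. exact: dualvec_h0. Qed.
Let Dh : D \in h0. Proof. exact: dualvec_h0. Qed.
Let Th : T \in h0. Proof. by rewrite ttau_D rpredZ. Qed.
Let Zh : Z \in h0. Proof. by rewrite rpredB ?rpredZ. Qed.

Let D0 : 0 < kf D D.
Proof. by rewrite (inner_gt0 kfP) ?dualvec_neq0 ?beta_neq0. Qed.

Let Dn0 : kf D D != 0. Proof. by rewrite gt_eqF. Qed.

Let rwtZ : rwt beta Z = 0.
Proof.
rewrite -(kf_dualvec cpt) // (innerBl kfP) (innerZl kfP) mulfVK //.
by rewrite (kf_dualvec cpt) // subrr.
Qed.

Let rwtT : rwt beta T = 2.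
Proof. by rewrite -(kf_dualvec cpt) // ttau_D (innerZl kfP) mulfVK. Qed.

Let Z0 : Z != 0.
Proof.
apply/eqP => /eqP; rewrite subr_eq0 => /eqP LD.
set c := kf L D / kf D D in LD.
have := @lin_indep 1 (- (c%:C)%C); rewrite scale1r scaleNr => h.
suff /h/eqP : lambda - (c%:C)%C *: beta = 0 by rewrite oner_eq0.
apply/eqP; rewrite subr_eq0; apply/eqP/wt_inj => H Hh.
rewrite /wt scale_lfunE -!/(wt _ _) !wt_imag // -!(kf_dualvec cpt) // LD.
rewrite (innerZr kfP); apply/eqP; rewrite eq_complex /=.
by apply/andP; split; apply/eqP; ring.
Qed.

Lemma wpair_orth H x y : H \in h0 -> wpair h0 br (rwt beta) x y -> kf H x = 0.
Proof.
move=> Hh xy; have [_ e] := xy D Dh.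
have : kf H (br D y) = 0.
  rewrite (innerC kfP) (killing_ip_inv lie) (h0_abelian maxab) //.
  by rewrite (inner0r kfP) oppr0.
rewrite e (innerZr kfP) -(kf_dualvec cpt) // => /eqP; rewrite mulf_eq0.
by rewrite (negPf Dn0) => /eqP.
Qed.

Let kf_pq : kf p q = 0.
Proof.
have [_ e] := pq Dh; have : kf (br D q) q = 0.
  by have := killing_ip_inv lie D q q; rewrite (innerC kfP q); lra.
rewrite e (innerZl kfP) -(kf_dualvec cpt) // => /eqP; rewrite mulf_eq0.
by rewrite (negPf Dn0) => /eqP.
Qed.

Lemma mem_g0_root x : x \in g0_root br beta <->
  exists y, wpair h0 br (rwt beta) x y.
Proof. exact: real_points_wpair. Qed.

(** The vectors that correspond to 1, i, j, k. *)
Definition string_basis : seq g0 := [:: Z; T; 2 *: p; - 2 *: q].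

Lemma string_basis_free : free string_basis.
Proof.
have q0 : q != 0.
  by apply: contra p0 => /eqP/(wpair_rwt_eq0 ib beta_neq0 pq)/eqP.
have T0 : T != 0.
  apply/eqP => T0; have := rwtT; rewrite T0 -(kf_dualvec cpt) ?mem0v //.
  by rewrite (inner0l kfP) => /eqP; rewrite eq_sym pnatr_eq0.
apply: (inner_orthogonal_free kfP) => /=.
  rewrite !inE !negb_or !(eq_sym 0) Z0 T0 !scaler_eq0 oppr_eq0 pnatr_eq0.
  by rewrite (negPf p0) (negPf q0).
have qp := wpair_rot pq; have Hp H (Hh : H \in h0) := wpair_orth Hh pq.
have Hq H (Hh : H \in h0) : kf H q = 0.
  by apply/eqP; rewrite -oppr_eq0 -(innerNr kfP); apply/eqP/(wpair_orth Hh qp).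
rewrite !(innerZr kfP) !(innerZl kfP) (Hp Z) // (Hp T) // (Hq Z) // (Hq T) //.
rewrite kf_pq !mulr0 eqxx /= !andbT.
rewrite ttau_D (innerZr kfP) [kf Z D](kf_dualvec cpt) // rwtZ mulr0.
by rewrite eqxx.
Qed.

Lemma g_string_span : glb = <<string_basis>>%VS.
Proof.
have g0r : g0_root br beta = (<[2 *: p]> + <[- 2 *: q]>)%VS.
  apply/vspaceP => x; apply/idP/memv_addP.
    case/mem_g0_root => y /root1[a [c [-> _]]].
    exists (a *: p).
      by apply/vlineP; exists (a / 2); rewrite scalerA mulfVK ?pnatr_eq0.
    exists (- c *: q); last by rewrite scaleNr.
    apply/vlineP; exists (c / 2).
    by rewrite scalerA mulrN mulfVK ?pnatr_eq0.
  case=> _ /vlineP[a ->] [_ /vlineP[c ->] ->]; rewrite !scalerA.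
  apply/mem_g0_root; exists ((a * 2) *: q - (c * - 2) *: p).
  have := wpair_lin (a * 2) pq
    (wpair_lin (- (c * - 2)) (wpair_rot pq) (wpair0 br (rwt beta))).
  by rewrite !addr0 scalerN !scaleNr opprK.
have LZ : L = Z + (kf L D / 2) *: T.
  rewrite ttau_D scalerA mulrA divfK ?pnatr_eq0 //.
  by rewrite /string_center subrK.
have sb x : x \in string_basis -> x \in <<string_basis>>%VS by exact: memv_span.
rewrite /g_string Htilde_dualvec g0r.
apply/eqP; rewrite eqEsubv; apply/andP; split.
  rewrite !subv_add -!memvE; apply/andP; split; [apply/andP; split|].
  - by apply/andP; split; apply: sb; rewrite !inE eqxx ?orbT.
  - by rewrite LZ; apply: rpredD; [|apply: rpredZ]; apply: sb;
      rewrite !inE eqxx ?orbT.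
  - by apply: sb; rewrite !inE eqxx ?orbT.
apply/span_subvP => x; rewrite !inE => /or4P[] /eqP->.
- rewrite (_ : Z = L - (kf L D / 2) *: T); last by rewrite {1}LZ addrK.
  apply: rpredB; last by rewrite rpredZ // mem_addvr ?memv_line.
  by apply/mem_addvl/mem_addvr/memv_line.
- exact/mem_addvr/memv_line.
- exact/mem_addvl/mem_addvl/mem_addvl/memv_line.
exact/mem_addvl/mem_addvl/mem_addvr/memv_line.
Qed.

Lemma glb_commutators :
  [/\ br Z T = 0, br Z (2 *: p) = 0, br Z (- 2 *: q) = 0 &
   [/\ br T (2 *: p) = 2 *: (- 2 *: q), br (2 *: p) (- 2 *: q) = 2 *: T
     & br (- 2 *: q) T = 2 *: (2 *: p)]].
Proof.
have [Zp Zq] := pq Zh; have [Tp Tq] := pq Th.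
rewrite rwtZ !scale0r oppr0 in Zp Zq; rewrite rwtT in Tp Tq.
split; first exact: h0_abelian maxab _ _ Zh Th.
- by rewrite linearZr_LR /= Zp scaler0.
- by rewrite linearZr_LR /= Zq scaler0.
split.
- by rewrite linearZr_LR /= Tp scalerN !scaleNr scalerN.
- by rewrite linearZr_LR linearZl_LR /= ttau_pq !scalerA; congr (_ *: _); ring.
- rewrite linearZl_LR /= (lie_anti lie) Tq scaleNr scalerN opprK //.
Qed.

Lemma ttau_glb : T \in glb. Proof. exact/mem_addvr/memv_line. Qed.

Lemma D_glb : D \in glb.
Proof.
have -> : D = (kf D D / 2) *: T; last by rewrite rpredZ ?ttau_glb.
by rewrite ttau_D scalerA mulrA divfK ?pnatr_eq0 // mulfV // scale1r.
Qed.

Lemma L_glb : L \in glb.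
Proof.
rewrite /g_string Htilde_dualvec.
exact/mem_addvl/mem_addvr/memv_line.
Qed.

Lemma root_glb x y : wpair h0 br (rwt beta) x y -> x \in glb.
Proof.
by move=> xy; apply/mem_addvl/mem_addvl/mem_g0_root; exists y.
Qed.

(** Take u and v in the summands k and j. The part of [u, v] of weight
    2 lambda + (k + j) beta is 0 by hypothesis ([sum0]), and the remaining part
    has weight (k - j) beta ([diff]). *)
Lemma nb_string :
  (forall k : int, ~~ is_root br (lambda *+ 2 + beta *~ k)) ->
  {in U' &, forall u v, nb u v \in glb}.
Proof.
move=> nroot u v uU; move: v; apply: U_string_ind => [|a v v' IH IH'|j v y' vy'].
- by rewrite linear0r mem0v.
- by rewrite linearPr /= rpredD ?rpredZ.
move: u uU; apply: U_string_ind => [|a u u' IH IH'|k u y uy].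
- by rewrite linear0l mem0v.
- by rewrite linearPl /= rpredD ?rpredZ.
have sum0 : nb u v - nb y y' = 0.
  apply: (wpair_not_weight (mu := lambda *+ 2 + beta *~ (k + j))
           (y := nb u y' + nb y v)) (nroot _) _.
  - by apply: imagD; [exact: imagMn|exact: imagMz].
  - exact: string2_neq0.
  apply: eq_wpair (wpair_mulD nb_der uy vy') => H _.
  by rewrite !rwtD !rwtMz intrD; ring.
have diff := wpair_mulB nb_der uy vy'.
rewrite (half_sum (nb u v) (nb y y')) sum0 add0r rpredZ //.
have {}diff : wpair h0 br (fun H => (k - j)%:~R * rwt beta H)
    (nb u v + nb y y') (nb y v - nb u y').
  by apply: eq_wpair diff => H _; rewrite !rwtD !rwtMz intrB; ring.
have [kj|kj] := eqVneq k j.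
  have nh : nb u v \in h0.
    suff : nb u v + nb u v \in h0.
      by rewrite -mulr2n -scaler_nat rpredZeq pnatr_eq0.
    apply: (mem_h0 lie maxab) => H Hh; have [e _] := diff H Hh.
    move: e; rewrite kj subrr mul0r scale0r oppr0.
    by move/eqP: sum0; rewrite subr_eq0 => /eqP <-.
  (* H pairs with [u, v] as H u = - m(H) y pairs with v, where m is the real
     form of lambda + k beta. *)
  have nbD : nb u v = - uf y v *: dualvec br (lambda + beta *~ k).
    apply: (dualvec_uniq cpt) => // H Hh.
    rewrite (innerC kfP) (kf_nb ipUg ip_killing nbrP).
    by have [-> _] := uy H Hh; rewrite (innerNl ufP) (innerZl ufP) mulNr mulrC.
  suff : nb u v \in glb.
    by move=> nbg; move/eqP: sum0; rewrite subr_eq0 => /eqP <-; rewrite rpredD.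
  by rewrite nbD (dualvecDz cpt) rpredZ ?rpredD ?rpredZ ?L_glb ?D_glb.
have [k1|k1] := eqVneq (k - j) 1.
  apply: (root_glb (y := nb y v - nb u y')).
  by apply: eq_wpair diff => H _; rewrite k1 mul1r.
have [k2|k2] := eqVneq (k - j) (-1).
  apply: (root_glb (y := - (nb y v - nb u y'))).
  by apply: eq_wpair (wpair_conj diff) => H _; rewrite k2 mulN1r opprK.
suff -> : nb u v + nb y y' = 0 by rewrite mem0v.
apply: (wpair_multiple_int lie cpt maxab ib beta_neq0 p0 pq root1 _ k1 k2 diff).
by rewrite subr_eq0.
Qed.

Lemma submodule_string : submodule act glb U'.
Proof.
move=> x u; rewrite /g_string Htilde_dualvec.
move=> /memv_addP[_ /memv_addP[y yb [_ /vlineP[a ->] ->]] [_ /vlineP[c ->] ->]] uU.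
rewrite !linearDl !linearZl_LR /= !rpredD ?rpredZ //; try exact: act_h0_string.
by have /mem_g0_root[z yz] := yb; exact: act_root_string yz uU.
Qed.

(** On every U_(lambda + k beta) the vector Z squares to the same negative
    scalar, because beta vanishes on Z. *)
Lemma string_center_sq : {in U', forall u,
  act Z (act Z u) = - (kf Z Z) ^+ 2 *: u}.
Proof.
have lZ : rwt lambda Z = kf Z Z.
  rewrite -(kf_dualvec cpt) // {3}/string_center (innerBr kfP) (innerZr kfP).
  by rewrite [kf Z D](kf_dualvec cpt) // rwtZ mulr0 subr0.
apply: U_string_ind => [|a u v IH IH'|k u y uy].
- by rewrite !linear0r scaler0.
- by rewrite !linearPr /= IH IH' scalerDr !scalerA mulrC.
have [-> e] := uy Z Zh; rewrite linearNr linearZr_LR /= e.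
by rewrite rwtD rwtMz rwtZ mulr0 addr0 lZ scalerA scaleNr.
Qed.

Lemma string_center_inj : {in U', forall u, act Z u = 0 -> u = 0}.
Proof.
move=> u uU u0; have := string_center_sq uU; rewrite u0 linear0r => /esym/eqP.
rewrite scaler_eq0 oppr_eq0 expf_eq0 /= => /orP[/eqP/(inner_eq0 kfP)/eqP|/eqP //].
by rewrite (negPf Z0).
Qed.

End Root.
End String.

(** * Products of subspaces *)

Section Prodv.
Variables (F : fieldType) (V1 V2 : vectType F).

Definition inlv (u : V1) : V1 * V2 := (u, 0).
Definition inrv (Z : V2) : V1 * V2 := (0, Z).

Fact inlv_linear : linear inlv.
Proof. by move=> a u v; congr pair; rewrite /= scaler0 addr0. Qed.
Fact inrv_linear : linear inrv.
Proof. by move=> a u v; congr pair; rewrite /= scaler0 addr0. Qed.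

HB.instance Definition _ :=
  GRing.isLinear.Build F V1 (V1 * V2)%type _ inlv inlv_linear.
HB.instance Definition _ :=
  GRing.isLinear.Build F V2 (V1 * V2)%type _ inrv inrv_linear.

Lemma mem_prodv (W1 : {vspace V1}) (W2 : {vspace V2}) x :
  (x \in prodv W1 W2) = (x.1 \in W1) && (x.2 \in W2).
Proof.
rewrite /prodv mem_vspan_submod => [||a u v [u1 u2] [v1 v2]] /=.
- by apply/asboolP/andP.
- by rewrite !mem0v.
- by rewrite !rpredD ?rpredZ.
Qed.

Lemma prodv_basis (W1 : {vspace V1}) (W2 : {vspace V2}) e1 e2 :
  basis_of W1 e1 -> basis_of W2 e2 ->
  basis_of (prodv W1 W2) (map inlv e1 ++ map inrv e2).
Proof.
move=> b1 b2; pose f := linfun inlv; pose g := linfun inrv.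
have fE u : f u = (u, 0) by rewrite lfunE.
have gE u : g u = (0, u) by rewrite lfunE.
have -> : prodv W1 W2 = (f @: W1 + g @: W2)%VS.
  apply/vspaceP => -[u Z]; rewrite mem_prodv /=; apply/andP/memv_addP.
    move=> [uW ZW]; exists (f u); first exact: memv_img.
    exists (g Z); first exact: memv_img.
    by rewrite fE gE; congr pair; rewrite /= ?addr0 ?add0r.
  case=> _ /memv_imgP[v vW ->] [_ /memv_imgP[Y YW ->]]; rewrite fE gE => -[-> ->].
  by rewrite addr0 add0r.
rewrite -(eq_map (lfunE _)) -(eq_map (lfunE inrv)).
apply: cat_basis; first 1 last.
- apply: limg_basis_of b1; apply/eqP; rewrite -subv0; apply/subvP => u.
  rewrite memv_cap memv_ker memv0 lfunE => /andP[_ /eqP[->]].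
  by rewrite eqxx.
- apply: limg_basis_of b2; apply/eqP; rewrite -subv0; apply/subvP => u.
  rewrite memv_cap memv_ker memv0 lfunE => /andP[_ /eqP[->]].
  by rewrite eqxx.
apply/directv_addP/eqP; rewrite -subv0; apply/subvP => x.
rewrite memv_cap => /andP[/memv_imgP[u _ ->] /memv_imgP[Z _]].
by rewrite !lfunE /= memv0 => -[-> _].
Qed.

End Prodv.

(** * Rationality *)

Section Rational.
Variable R : realFieldType.

Definition rational (x : R) : Prop := exists q : rat, x = ratr q.

Lemma rationalD x y : rational x -> rational y -> rational (x + y).
Proof. by move=> [a ->] [b ->]; exists (a + b); rewrite rmorphD. Qed.

Lemma rationalN x : rational x -> rational (- x).
Proof. by move=> [a ->]; exists (- a); rewrite rmorphN. Qed.

Lemma rationalM x y : rational x -> rational y -> rational (x * y).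
Proof. by move=> [a ->] [b ->]; exists (a * b); rewrite rmorphM. Qed.

Lemma rationalV x : rational x -> rational x^-1.
Proof. by move=> [a ->]; exists a^-1; rewrite fmorphV. Qed.

Lemma rational_nat n : rational n%:R.
Proof. by exists n%:R; rewrite rmorph_nat. Qed.

Lemma rational_sum I (r : seq I) (P : pred I) (F : I -> R) :
  (forall i, P i -> rational (F i)) -> rational (\sum_(i <- r | P i) F i).
Proof.
move=> ratF; elim/big_ind: _ => //; first exact: (rational_nat 0).
exact: rationalD.
Qed.

Variable V : vectType R.
Implicit Type S : set V.

Lemma qspan_mem S v : S v -> qspan S v.
Proof.
move=> Sv; exists 1%N, (fun=> 1), (fun=> v); split=> //.
by rewrite big_ord1 rmorph1 scale1r.
Qed.

Lemma qspan0 S : qspan S 0.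
Proof.
exists 0%N, (fun=> 0), (fun=> 0); split; last by rewrite big_ord0.
by case.
Qed.

Lemma qspanD S u v : qspan S u -> qspan S v -> qspan S (u + v).
Proof.
move=> [m [c [s [Ss ->]]]] [n [d [t [St ->]]]].
exists (m + n)%N, (fun i => match split i with inl j => c j | inr j => d j end),
  (fun i => match split i with inl j => s j | inr j => t j end).
split=> [i|]; first by case: split.
rewrite big_split_ord /=; congr (_ + _); apply: eq_bigr => i _.
  by rewrite (unsplitK (inl i)).
by rewrite (unsplitK (inr i)).
Qed.

Lemma qspanZ S a v : rational a -> qspan S v -> qspan S (a *: v).
Proof.
move=> [q ->] [n [c [s [Ss ->]]]]; exists n, (fun i => q * c i), s; split=> //.
by rewrite scaler_sumr; apply: eq_bigr => i _; rewrite scalerA rmorphM.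
Qed.

Lemma qspan_sum S I (r : seq I) (P : pred I) (F : I -> V) :
  (forall i, P i -> qspan S (F i)) -> qspan S (\sum_(i <- r | P i) F i).
Proof.
move=> qF; elim/big_ind: _ => //; first exact: qspan0.
exact: qspanD.
Qed.

Lemma qspan_coef (e : seq V) u a : free e -> u \in e ->
  qspan [set` e] (a *: u) -> rational a.
Proof.
move=> fe ue [n [c [s [Ss au]]]].
pose i := Ordinal (etrans (index_mem u e) ue).
have eE (v : V) (ve : v \in e) :
    v = (in_tuple e)`_(Ordinal (etrans (index_mem v e) ve)) by rewrite /= nth_index.
have cE v : v \in e -> rational (coord (in_tuple e) i v).
  by move=> ve; rewrite [v]eE coord_free //; exact: rational_nat.
have cu : coord (in_tuple e) i u = 1.
  have := coord_free i i (fe : free (in_tuple e)).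
  by rewrite /= nth_index // eqxx.
have := congr1 (coord (in_tuple e) i) au.
rewrite linearZ linear_sum /= cu mulr1 => ->.
apply: rational_sum => j _; rewrite linearZ /=.
by apply: rationalM; [exists (c j)|apply/cE/Ss].
Qed.

(** The coefficients of v on T solve a linear system whose matrix, the Gram matrix
    of T, and whose right-hand side are rational. A rational system with a real
    solution has a rational one, and the vector w that it defines is v, because
    v - w lies in the span of T and is orthogonal to T. *)
Lemma qspan_gram (b : V -> V -> R) (T : seq V) v : inner_product b ->
  {in T &, forall x y, rational (b x y)} -> v \in <<T>>%VS ->
  {in T, forall x, rational (b v x)} -> qspan [set` T] v.
Proof.
move=> bP gT vT rv; pose n := size T.
have Tn (i : 'I_n) : T`_i \in T by rewrite mem_nth.
have [G GP] := choice (fun k : 'I_n * 'I_n => gT _ _ (Tn k.1) (Tn k.2)).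
have [r rP] := choice (fun i => rv _ (Tn i)).
pose Gm := \matrix_(i, j) G (i, j); pose rm := \row_j r j.
have vE := coord_span (X := in_tuple T) vT.
pose x := \row_(i < n) coord (in_tuple T) i v.
have xG : x *m map_mx (ratr : rat -> R) Gm = map_mx (ratr : rat -> R) rm.
  apply/rowP => j; rewrite !mxE -rP [in RHS]vE (inner_suml bP).
  by apply: eq_bigr => i _; rewrite !mxE -(GP (i, j)) (innerZl bP).
have : (map_mx (ratr : rat -> R) rm <= map_mx (ratr : rat -> R) Gm)%MS.
  by rewrite -xG submxMl.
rewrite map_submx => /submxP[y ry].
pose w := \sum_(i < n) (ratr (y 0 i) : R) *: T`_i.
suff -> : v = w.
  by exists n, (fun i => y 0 i), (fun i => T`_i); split=> // i; exact: Tn.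
have bw (j : 'I_n) : b w T`_j = b v T`_j.
  rewrite (inner_suml bP) rP; have := congr1 (fun A : 'rV_n => A 0 j) ry.
  rewrite !mxE => ->; rewrite rmorph_sum; apply: eq_bigr => i _ /=.
  by rewrite (innerZl bP) (GP (i, j)) rmorphM !mxE.
have wT : w \in <<T>>%VS.
  by apply: memv_suml => i _; rewrite rpredZ ?memv_span.
apply/eqP; rewrite -subr_eq0; apply/eqP/(inner_eq0 bP).
have /(coord_span (X := in_tuple T)) dE : v - w \in <<T>>%VS by rewrite rpredB.
rewrite {2}dE (inner_sumr bP) big1 // => i _.
by rewrite (innerZr bP) (innerBl bP) bw subrr mulr0.
Qed.

End Rational.

Lemma qspan_linear (F : fieldType) (V V' : vectType F) (f : V -> V')
    (S : set V) (S' : set V') v : linear f ->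
  (forall s, S s -> S' (f s)) -> qspan S v -> qspan S' (f v).
Proof.
move=> fP SS' [n [c [s [Ss ->]]]]; exists n, c, (f \o s).
by split=> [i|]; [exact: SS'|rewrite (linear_combP fP)].
Qed.

(** * Rationality of the dual vectors *)

Section DualRational.
Variables (R : realType) (g0 U : vectType R).
Variables (br : {bilinear g0 -> g0 -> g0}) (act : {bilinear g0 -> U -> U}).
Variables (h0 : {vspace g0}) (Delta : seq (hdual h0)) (X : hdual h0 -> cplx g0).
Variable B0 : seq U.
Variable ip : {dot (U * g0)%type for @idfun R}.
Hypotheses (lie : is_lie_bracket br) (cpt : compact_semisimple br).
Hypothesis maxab : maximal_abelian br h0.
Hypotheses (base : is_root_base br Delta) (chev : chevalley_basis br Delta X).
Local Notation C0 := (compact_basis br Delta X).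
Hypothesis adapted : adapted_basis act h0 C0 B0.
Hypothesis ipP : compatible_inner_product br act C0 B0 ip.
Local Notation kf := (killing_ip br).
Local Notation T alpha := (ttau br alpha).
Let kfP := killing_ipP cpt.

Lemma ttau_gram : {in Delta &, forall alpha alpha',
  rational (kf (T alpha) (T alpha'))}.
Proof.
have [_ _ ipK ipQ] := ipP.
move=> alpha alpha' aD aD'; rewrite /killing_ip -ipK.
apply: ipQ; right; first by exists (T alpha) => //; exact: ttau_compact.
by exists (T alpha') => //; exact: ttau_compact.
Qed.

(** If D is the dual vector, then i tau_alpha = (2 / |D|^2) D, so that
    D = (2 / |i tau_alpha|^2) i tau_alpha, with a rational coefficient. *)
Lemma simple_dualvec_rational alpha :
  alpha \in Delta -> qspan C0 (dualvec br alpha).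
Proof.
move=> aD; have im := simple_imag lie cpt base aD.
have Dn0 : kf (dualvec br alpha) (dualvec br alpha) != 0.
  rewrite gt_eqF // (inner_gt0 kfP) // (dualvec_neq0 cpt) //.
  exact: root_neq0 (simple_root base aD).
have -> : dualvec br alpha = (2 / kf (T alpha) (T alpha)) *: T alpha.
  rewrite (ttau_dualvec cpt) // (innerZl kfP) (innerZr kfP) scalerA.
  rewrite -[LHS]scale1r; congr (_ *: _); field.
  by rewrite Dn0.
apply: qspanZ; last by apply: qspan_mem; exact: ttau_compact.
by apply: rationalM; [exact: rational_nat|apply/rationalV/ttau_gram].
Qed.

(** Dual vectors, unlike coroots, are additive in the root. *)
Lemma positive_dualvec_rational beta : positive_root br Delta beta ->
  qspan C0 (dualvec br beta).
Proof.
move=> [_ [c ->]].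
have -> : dualvec br (\sum_(i < size Delta) Delta`_i *+ c i) =
    \sum_(i < size Delta) (c i)%:R *: dualvec br Delta`_i.
  rewrite -[LHS]scale1r; symmetry; apply: (dualvec_uniq cpt) => [|H Hh].
    by apply: memv_suml => i _; rewrite rpredZ ?(dualvec_h0 cpt).
  have rwtDH : {morph (fun mu : hdual h0 => rwt mu H) : x y / x + y}.
    by move=> x y; exact: rwtD.
  have rwt0H : rwt (0 : hdual h0) H = 0 by exact: rwt0.
  rewrite mul1r (inner_sumr kfP) (big_morph _ rwtDH rwt0H).
  by apply: eq_bigr => i _; rewrite (innerZr kfP) (kf_dualvec cpt) // rwtMn.
apply: qspan_sum => i _; apply: qspanZ; first exact: rational_nat.
by apply/simple_dualvec_rational/mem_nth.
Qed.

Variable lambda : hdual h0.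
Hypotheses (wl : is_U_weight act lambda) (il : imag lambda).

(** The product of two simple coroots acts on a vector of B_0 in U_lambda as a
    scalar, and it preserves the rational span of B_0. *)
Lemma weight_product_rational : {in Delta &, forall alpha alpha',
  rational (rwt lambda (T alpha) * rwt lambda (T alpha'))}.
Proof.
move=> alpha alpha' aD aD'; have [B0b [b [bb bB]] B0C] := adapted.
have l0 : lambda != 0 by case/andP: wl.
have [x [y [xy x0]]] := nonzero_weight_wpair il wl.
have xU : x \in U_weight act lambda by apply/U_weight_wpair => //; exists y.
have bl := bb _ (or_intror wl).
have [u ub] : exists u, u \in b lambda.
  case: (b lambda) bl => [|u s] bl; last by exists u; rewrite mem_head.
  by move: xU x0; rewrite -(span_basis bl) span_nil memv0 => ->.
have uB : u \in B0 by apply/bB; exists lambda => //; right.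
have /(U_weight_wpair act u il l0)[w uw] := basis_mem bl ub.
have Th a : a \in Delta -> T a \in h0.
  by move=> aD''; apply/(ttau_h0 cpt)/(simple_imag lie cpt base).
have C0T a : a \in Delta -> C0 (T a) by exact: ttau_compact.
have : qspan [set` B0] (act (T alpha) (act (T alpha') u)).
  by apply/(B0C _ _ (C0T _ aD))/(B0C _ _ (C0T _ aD'))/qspan_mem.
have [-> _] := uw _ (Th _ aD'); have [_ e] := uw _ (Th _ aD).
rewrite linearNr linearZr_LR /= e scalerA -scaleNr.
move/(qspan_coef (basis_free B0b) uB)/rationalN; rewrite opprK.
by rewrite mulrC.
Qed.

(** With lambda = i m, the factor c = m(i tau_alpha), for some simple alpha at
    which it is nonzero, makes the inner products of c H~_lambda with the coroots the rational
    products m(i tau_alpha) m(i tau_alpha'). *)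
Lemma weight_dualvec_rational : exists2 c : R,
  c != 0 & qspan C0 (c *: dualvec br lambda).
Proof.
pose Ts := [seq T alpha | alpha <- Delta].
have spanT : {in h0, forall H, H \in <<Ts>>%VS}.
  exact: h0_span lie cpt maxab base chev.
have [alpha aD la] : exists2 alpha, alpha \in Delta & rwt lambda (T alpha) != 0.
  apply: contrapT => noa; have D0 : dualvec br lambda = 0.
    have DT := spanT _ (dualvec_h0 cpt lambda).
    have /= DE := coord_span (X := in_tuple Ts) DT.
    apply: (inner_eq0 kfP); rewrite {1}DE (inner_suml kfP) big1 // => i _.
    have /mapP[a aD ->] : Ts`_i \in Ts by rewrite mem_nth.
    rewrite (innerZl kfP) (kf_dualvec cpt); last first.
      by apply/(ttau_h0 cpt)/(simple_imag lie cpt base).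
    apply/eqP; rewrite mulf_eq0; apply/orP; right; apply: contraT => la.
    by case: noa; exists a.
  have l0 : lambda != 0 by case/andP: wl.
  by have := dualvec_neq0 cpt il l0; rewrite D0 eqxx.
exists (rwt lambda (T alpha)) => //.
suff : qspan [set` Ts] (rwt lambda (T alpha) *: dualvec br lambda).
  apply: (@qspan_linear R g0 g0 id) => // _ /mapP[a aD' ->].
  exact: ttau_compact.
apply: (qspan_gram kfP) =>
  [_ _ /mapP[a aD' ->] /mapP[a' aD'' ->]||_ /mapP[a aD' ->]].
- exact: ttau_gram.
- by apply/spanT; rewrite rpredZ ?(dualvec_h0 cpt).
rewrite (innerZl kfP) (innerC kfP) (kf_dualvec cpt); last first.
  by apply/(ttau_h0 cpt)/(simple_imag lie cpt base).
exact: weight_product_rational.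
Qed.

End DualRational.

(** * The theorem *)

Theorem proposition10p4 (R : realType) (g0 U : vectType R)
    (br : {bilinear g0 -> g0 -> g0}) (act : {bilinear g0 -> U -> U})
    (h0 : {vspace g0}) (Delta : seq (hdual h0)) (X : hdual h0 -> cplx g0)
    (B0 : seq U)
    (ip : {dot (U * g0)%type for @idfun R})
    (nbr : {bilinear (U * g0)%type -> (U * g0)%type -> (U * g0)%type})
    (lambda beta : hdual h0) :
  is_lie_bracket br -> compact_semisimple br -> is_lie_action br act ->
  maximal_abelian br h0 ->
  is_root_base br Delta -> chevalley_basis br Delta X ->
  adapted_basis act h0 (compact_basis br Delta X) B0 ->
  compatible_inner_product br act (compact_basis br Delta X) B0 ip ->
  is_n0_bracket act ip nbr ->
  is_U_weight act lambda -> positive_root br Delta beta ->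
  free [:: lambda; beta] ->
  let C0 := compact_basis br Delta X in
  let U' := U_string act lambda beta in
  let g_lb := g_string br ip lambda beta in
  let n_lb := prodv U' g_lb in
  [/\ [/\ subalgebra br g_lb, isomorphic_to_quaternions br g_lb
        & is_rational (qspan C0) g_lb],
      submodule act g_lb U'
    & (forall p : int, ~~ is_root br (lambda *+ 2 + beta *~ p)) ->
      [/\ subalgebra nbr n_lb, totally_geodesic ip nbr n_lb,
          lie_center nbr n_lb = prodv 0%VS g_lb, \dim (lie_center nbr n_lb) = 4%N
        & is_rational (qspan (n0_basis C0 B0)) n_lb]].
Proof.
move=> lie cpt actP maxab base chev adapted ipP nbrP wl pb fr C0 U' g_lb n_lb.
have [ipUg ipS ipK ipQ] := ipP.
have ufP := mod_ipP ip; have kfP := killing_ipP cpt.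
have ib : imag beta := root_imag lie cpt pb.1.
have act_skew : {in h0, forall H u v,
    mod_ip ip (act H u) v = - mod_ip ip u (act H v)}.
  by move=> H _ u v; exact: uf_skew ipS H u v.
have il : imag lambda := weight_imag ufP act_skew wl.
have [p [q [eX pq p0 tpq [Cp Cq]]]] := root_vector lie cpt chev pb.
have root1 := wpair_root_line lie cpt maxab base chev pb eX.
have tD := ttau_dualvec cpt ib.
have gE := g_string_span cpt ipK il ib pq root1 tD.
have sfree := string_basis_free lie cpt maxab il ib fr p0 pq tD.
rewrite -/g_lb in gE; set s := string_basis _ _ _ _ _ in gE sfree.
have gb : basis_of g_lb s by rewrite /basis_of gE eqxx.
have g4 : \dim g_lb = 4%N by exact: size_basis gb.
have [c1 c2 c3 [c4 c5 c6]] := glb_commutators lie cpt maxab ib fr pq tpq tD.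
have submod : submodule act g_lb U' := submodule_string cpt actP ipK il ib fr tD.
(* A rational basis of g_(lambda,beta): the dual vectors of lambda (rescaled)
   and of beta instead of Z and of the coroot. *)
have [eg egb egQ] : is_rational (qspan C0) g_lb.
  have [c cn0 cL] :=
    weight_dualvec_rational lie cpt maxab base chev adapted ipP wl il.
  have DQ := positive_dualvec_rational lie cpt base ipP pb.
  pose e := [:: c *: dualvec br lambda; dualvec br beta; 2 *: p; - 2 *: q].
  exists e; last first.
    move=> v; rewrite !inE => /or4P[] /eqP-> //; exact: qspan_mem.
  rewrite basisEdim g4 leqnn andbT gE; apply/span_subvP => v.
  have eS w : w \in e -> w \in <<e>>%VS by exact: memv_span.
  have De : dualvec br beta \in <<e>>%VS by apply: eS; rewrite !inE eqxx ?orbT.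
  have Le : dualvec br lambda \in <<e>>%VS.
    rewrite -[dualvec br lambda](scalerK cn0) rpredZ //.
    by apply: eS; rewrite !inE eqxx.
  rewrite !inE => /or4P[] /eqP->.
  - by rewrite /string_center rpredB ?rpredZ.
  - by rewrite tD rpredZ.
  - by apply: eS; rewrite !inE eqxx ?orbT.
  - by apply: eS; rewrite !inE eqxx ?orbT.
split.
- split.
  + by rewrite gE; exact: quaternion_subalgebra lie c1 c2 c3 c4 c5 c6.
  + by rewrite gE; exact: quaternion_isomorphism lie sfree c1 c2 c3 c4 c5 c6.
  + by exists eg.
- exact: submod.
move=> nroot.
have nbU : {in U' &, forall u v, nil_bracket nbr u v \in g_lb} :=
  nb_string lie cpt actP maxab ipUg ipS ipK nbrP il ib fr p0 pq root1 tD nroot.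
have nbrx x y : nbr x y = (0, nil_bracket nbr x.1 y.1).
  exact: nbrE nbrP x y.
have centerE : lie_center nbr n_lb = prodv 0%VS g_lb.
  apply/vspaceP => x; rewrite /lie_center mem_vspan_submod; last 2 first.
  - by split=> [|y _]; [exact: mem0v|exact: linear0l].
  - move=> a u v [uW uc] [vW vc]; split=> [|y yW]; first by rewrite rpredD ?rpredZ.
    by rewrite linearPl uc // vc // scaler0 addr0.
  rewrite mem_prodv memv0; apply/asboolP/andP => [[xW xc]|[/eqP x1 x2]].
    move: xW; rewrite mem_prodv => /andP[x1U x2g]; split=> //; apply/eqP.
    apply: (string_center_inj cpt il ib fr x1U); set Z := string_center _ _ _.
    have Zg : Z \in g_lb by rewrite gE memv_span ?mem_head.
    have ZxU : act Z x.1 \in U' by exact: submod.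
    (* |Z u|^2 is the inner product of Z with [u, Z u], and Z u is in U'. *)
    apply: (inner_eq0 ufP); rewrite -(kf_nb ipUg ipK nbrP).
    have := xc (act Z x.1, 0); rewrite mem_prodv ZxU mem0v nbrx => /(_ isT) [->].
    exact: inner0l kfP _.
  split=> [|y _]; first by rewrite mem_prodv x1 mem0v.
  by rewrite nbrx x1 linear0l.
have [nU nUb nUQ] : is_rational (qspan (n0_basis C0 B0)) n_lb.
  have [B0b [b [bb bB]] _] := adapted.
  (* Each U_(lambda + k beta) has a basis in B_0, so the vectors of B_0 lying in
     U' span it. *)
  have Ub : basis_of U' [seq u <- B0 | u \in U'].
    rewrite /basis_of (filter_free _ (basis_free B0b)) andbT eqEsubv.
    apply/andP; split; first by apply/span_subvP => u; rewrite mem_filter => /andP[].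
    apply: vspan_le => u [k]; have mu0 := string_neq0 fr k.
    case: (boolP (is_U_weight act (lambda + beta *~ k))) => [wk uk|nw].
      have bk := bb _ (or_intror wk).
      move: uk; rewrite -(span_basis bk); apply/subvP/sub_span => v vb.
      rewrite mem_filter; apply/andP; split; last first.
        by apply/bB; exists (lambda + beta *~ k) => //; right.
      by apply: mem_vspan; exists k; rewrite -(span_basis bk) memv_span.
    by rewrite /U_weight (negPf mu0) (negPf nw) memv0 => /eqP->; rewrite mem0v.
  exists (map (@inlv _ _ _) [seq u <- B0 | u \in U'] ++ map (@inrv _ _ _) eg).
    exact: prodv_basis.
  move=> v; rewrite mem_cat => /orP[] /mapP[w].
    rewrite mem_filter => /andP[_ wB] ->; apply: qspan_mem; left.
    by exists w.
  move=> /egQ wQ ->.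
  have Cr Y : C0 Y -> n0_basis C0 B0 (inrv U Y) by right; exists Y.
  exact: (qspan_linear (@inrv_linear R U g0) Cr wQ).
split.
- move=> x y; rewrite !mem_prodv => /andP[x1 _] /andP[y1 _].
  by rewrite nbrx /= mem0v nbU.
- exists (nil_nabla act nbr).
    exact: nil_nabla_levi_civita cpt ipUg ipS ipK nbrP.
  move=> x y; rewrite !mem_prodv => /andP[x1 x2] /andP[y1 y2].
  by rewrite /= rpredZ ?rpredD ?submod // rpredZ ?nbU.
- exact: centerE.
- by rewrite centerE (size_basis (prodv_basis (nil_basis _) gb)).
- by exists nU.
Qed.
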